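(* Let $d\ge 1$, $\alpha\in(0,2)$, $\beta\in(0,1)$ and $0<\eta\le \frac{\alpha}{\beta d}$. Let $V_0:\mathbb{R}^d\to[0,\infty)$ be a measurable function with $V_0\not\equiv 0$, and let $V:(0,\infty)\times\mathbb{R}^d\to[0,\infty]$ be a measurable function satisfying, for all $t>0$ and $x\in\mathbb{R}^d$, $$V(t,x)=\int_{\mathbb{R}^d}G(t,x-y)V_0(y)\,dy+\int_{\mathbb{R}^d}\int_0^t G(t-s,x-y)V(s,y)^{1+\eta}\,ds\,dy.$$ Then $V$ is not a global solution, in the sense that there exists $t_0>0$ such that $V(t,x)=\infty$ for all $t>t_0$ and all $x\in\mathbb{R}^d$.
   Context: $p(t,x)$ denotes the transition density of the symmetric $\alpha$-stable process on $\mathbb{R}^d$, characterized by $\int_{\mathbb{R}^d}e^{i\xi\cdot x}p(t,x)\,dx=e^{-t|\xi|^\alpha}$. $g_\beta$ is the density of $D_1$, where $D$ is a $\beta$-stable subordinator with $\mathbb{E}e^{-sD_t}=e^{-ts^\beta}$. The kernel $G$ is defined by $G(t,x)=\int_0^\infty p\big((t/u)^\beta,x\big)g_\beta(u)\,du$; it is the fundamental solution (heat kernel) of $\partial_t^\beta V=-(-\Delta)^{\alpha/2}V$ with Caputo time derivative $\partial_t^\beta$ of order $\beta$. A function satisfying the displayed integral equation is the integral solution of $\partial^\beta_tV=-(-\Delta)^{\alpha/2}V+I^{1-\beta}_t[V^{1+\eta}]$, $V(0,\cdot)=V_0$, where $I^{1-\beta}_tf(t)=\frac{1}{\Gamma(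1-\beta)}\int_0^t(t-\tau)^{-\beta}f(\tau)d\tau$.
   Formalization: The condition that V_0 is not identically 0 is taken in the almost-everywhere sense (the integral of V_0 is positive); for V_0 nonzero only on a null set, V = 0 solves the equation and the claim fails. *)

(* Defs.v *)
From HB Require Import structures.
From mathcomp Require Import all_boot all_order all_algebra.
From mathcomp Require Import all_classical all_reals all_analysis.
From mathcomp Require Import measurable_realfun.
Set Implicit Arguments. Unset Strict Implicit. Unset Printing Implicit Defensive.
Import Order.TTheory GRing.Theory Num.Theory.
Import numFieldNormedType.Exports.
Local Open Scope classical_set_scope.
Local Open Scope ring_scope.

(* Points of R^d are d-tuples of reals; [d.-tuple R] carries the product
   (Borel) sigma-algebra from the library (measure_tuple_display). *)

(* Lebesgue integral over R^n, written as the iterated one-dimensional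
   Lebesgue integral (equal to the integral w.r.t. n-dim Lebesgue measure
   by Tonelli/Fubini for the nonnegative / integrable integrands used here). *)
Fixpoint intRd (R : realType) (n : nat) : (n.-tuple R -> \bar R) -> \bar R :=
  match n return (n.-tuple R -> \bar R) -> \bar R with
  | 0 => fun f => f [tuple]
  | n'.+1 => fun f =>
      (\int[@lebesgue_measure R]_x intRd (fun y : n'.-tuple R => f (cons_tuple x y)))%E
  end.

Definition dotRd (R : realType) (d : nat) (x y : d.-tuple R) : R :=
  \sum_(i < d) tnth x i * tnth y i.
Definition normRd (R : realType) (d : nat) (x : d.-tuple R) : R :=
  Num.sqrt (\sum_(i < d) tnth x i ^+ 2).
Definition subRd (R : realType) (d : nat) (x y : d.-tuple R) : d.-tuple R :=
  [tuple tnth x i - tnth y i | i < d].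

(* p is the transition density of the symmetric alpha-stable process on R^d:
   p(t,.) >= 0 and its Fourier transform is exp(-t|xi|^alpha), written as
   real and imaginary parts of  int e^{i xi.x} p(t,x) dx. *)
Definition is_sym_stable_density (R : realType) (d : nat) (alpha : R)
  (p : R -> d.-tuple R -> R) : Prop :=
  measurable_fun ((`]0%R, +oo[%classic : set R) `*` [set: d.-tuple R]) (fun z : R * d.-tuple R => p z.1 z.2) /\
  (forall t x, 0 < t -> 0 <= p t x) /\
  (forall t (xi : d.-tuple R), 0 < t ->
     intRd (fun x => (cos (dotRd xi x) * p t x)%:E) = (expR (- (t * normRd xi `^ alpha)))%:E /\
     intRd (fun x => (sin (dotRd xi x) * p t x)%:E) = 0%E).

(* g is the density (on (0,oo)) of D_1 for a beta-stable subordinator D with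
   E e^{-s D_t} = e^{-t s^beta}. *)
Definition is_stable_subordinator_density (R : realType) (beta : R)
  (g : R -> R) : Prop :=
  measurable_fun (`]0%R, +oo[%classic : set R) g /\
  (forall u, 0 < u -> 0 <= g u) /\
  (forall s, 0 <= s ->
     (\int[@lebesgue_measure R]_(u in (`]0%R, +oo[%classic : set R)) (expR (- (s * u)) * g u)%:E)%E
       = (expR (- (s `^ beta)))%:E).

Definition Gkernel (R : realType) (d : nat) (beta : R)
  (p : R -> d.-tuple R -> R) (g : R -> R) (t : R) (x : d.-tuple R) : \bar R :=
  (\int[@lebesgue_measure R]_(u in (`]0%R, +oo[%classic : set R)) (p ((t / u) `^ beta) x * g u)%:E)%E.

(* Main.v *)
(* Write kappa := beta d / alpha.  Testing the characteristic function of
   p(t,.) against products of Poisson kernels and letting them concentrate gives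
   Fourier inversion on boxes; since exp(-t|xi|^alpha) has a finite first
   moment, the inverted function is close to its value at 0 near the origin, so that
   p(t,x) >= c t^(-d/alpha) for almost every |x| <= delta t^(1/alpha).
   The subordinator has mass arbitrarily near 0, hence for every L there is c_L with
   G(t,x) >= c_L t^(-kappa) almost everywhere on |x| <= L t^(beta/alpha).

   The linear term then yields V >= A t^(-kappa) on the cubes |x| < t^(beta/alpha) for
   large t.  Reinserting this bound into the source term gains, because
   kappa eta <= 1, the factor \int ds/s = log t: so A may be taken arbitrarily
   large.  Once A exceeds a threshold, iterating over the times T (2 - 2^(-k)) multiplies
   the lower bound by a fixed factor > 1 at each step, so V is infinite on a cube
   during [2T, 3T], and one more application of the source term spreads this to
   all of space. *)

Require Import Defs.
From HB Require Import structures.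
From mathcomp Require Import all_boot all_order all_algebra.
From mathcomp Require Import all_classical all_reals all_analysis.
From mathcomp Require Import measurable_realfun.
From mathcomp Require Import ring lra.
Set Implicit Arguments. Unset Strict Implicit. Unset Printing Implicit Defensive.
Import Order.TTheory GRing.Theory Num.Theory.
Import numFieldNormedType.Exports.
Local Open Scope classical_set_scope.
Local Open Scope ring_scope.

(** * Lebesgue measure on tuples *)

(** Only the characteristic function of p(t,.) is given, so its values are accessible only up to
    null sets. Bounds on p therefore hold almost everywhere, and those on G are stated after
    convolution with a nonnegative function, which is the form in which the integral equation
    consumes them. Poisson kernels reduce the inversion to one-dimensional calculus: exp(-e|s|) has
    elementary primitives against cosines, its transform integrates to arctangents, and both
    tensorise. Cubes replace balls for the same reason. The subordinator's mass is taken on an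
    interval [a, b]. A small b widens the cube on which the bound holds by the factor
    b^(-beta/alpha), which is how an arbitrary L arises; a > 0 keeps the height a^kappa positive. In
    the final iteration the time windows shrink like 2^(-k). The growth rate lam is fixed by lam^eta
    = 2, so that the nonlinearity returns exactly the lost factor 2^k. *)

Section lebesgue_tuple_measure.
Context (R : realType) (n : nat).
Variable m : {sigma_finite_measure set (n.-tuple R) -> \bar R}.

Definition consRd (z : measurableTypeR R * n.-tuple R) : n.+1.-tuple R :=
  cons_tuple z.1 z.2.

Lemma measurable_consRd : measurable_fun setT consRd.
Proof.
apply: (@measurable_cons _ _ _ R (fun z => z.1) n (fun z => z.2)).
  exact: measurable_fst.
exact: measurable_snd.
Qed.

(** The image of a product under [cons_tuple], so that Tonelli on the product reproduces the
    recursion of [intRd]. *)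
Definition lebRdS : set (n.+1.-tuple R) -> \bar R :=
  pushforward (@lebesgue_measure R \x m)%E consRd.

Let lebRdS0 : lebRdS set0 = 0%E.
Proof. by rewrite /lebRdS /pushforward preimage_set0 measure0. Qed.

Let lebRdS_ge0 A : (0 <= lebRdS A)%E.
Proof. by rewrite /lebRdS /pushforward; exact: measure_ge0. Qed.

Let lebRdS_sigma_additive : semi_sigma_additive lebRdS.
Proof.
move=> F mF tF mUF; rewrite /lebRdS /pushforward preimage_bigcup.
apply: measure_semi_sigma_additive.
- by move=> k; rewrite -[X in measurable X]setTI; exact: measurable_consRd.
- apply/trivIsetP => /= i j _ _ ij; rewrite -preimage_setI.
  by move/trivIsetP : tF => /(_ _ _ _ _ ij) ->//; rewrite preimage_set0.
- by rewrite -preimage_bigcup -[X in measurable X]setTI; exact: measurable_consRd.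
Qed.

HB.instance Definition _ := isMeasure.Build _ _ _ lebRdS
  lebRdS0 lebRdS_ge0 lebRdS_sigma_additive.

Let lebRdS_sigma_finite : sigma_finite setT lebRdS.
Proof.
(* Increasing exhaustions of both factors are taken, so that any point lies in the product of the
   k-th sets for one common index k. *)
have [F TF mF] : sigma_finite setT (@lebesgue_measure R \x m)%E.
  have /sigma_finiteP[F [TF ndF Foo]] := sigma_finiteT (@lebesgue_measure R).
  have /sigma_finiteP[G [TG ndG Goo]] := sigma_finiteT m.
  exists (fun k => F k `*` G k).
    rewrite -setXTT TF TG predeqE => -[x y]; split.
      move=> [/= [k _ Fkx] [l _ Gly]]; exists (maxn k l) => //; split.
      - by move: x Fkx; exact/subsetPset/ndF/leq_maxl.
      - by move: y Gly; exact/subsetPset/ndG/leq_maxr.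
    by move=> [k _ []/= ? ?]; split; exists k.
  move=> k; have [? ?] := Foo k; have [? ?] := Goo k.
  split; first exact: measurableX.
  by rewrite product_measure1E// lte_mul_pinfty// ge0_fin_numE.
(* A measurable left inverse of [consRd], which transports the cover of the product to tuples. *)
pose u (x : n.+1.-tuple R) : measurableTypeR R * n.-tuple R :=
  (thead x, [tuple of behead x]).
have uK z : u (consRd z) = z.
  by case: z => a b; rewrite /u /consRd/= theadE; congr pair; apply: val_inj.
have mu : measurable_fun setT u.
  by apply/measurable_fun_pairP; split; [exact: measurable_tnth|exact: measurable_behead].
exists (fun k => u @^-1` F k).
  by rewrite -preimage_bigcup -TF preimage_setT.
move=> k; have [mFk Fkoo] := mF k; split.
  by rewrite -[X in measurable X]setTI; exact: mu.
rewrite /= /lebRdS /pushforward (_ : _ @^-1` _ = F k)//.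
by apply/seteqP; split => z /=; rewrite uK.
Qed.

HB.instance Definition _ := Measure_isSigmaFinite.Build _ _ _ lebRdS
  lebRdS_sigma_finite.

End lebesgue_tuple_measure.

(** Sigma-finiteness is carried through the recursion because the product measure one dimension up
    requires it. The point mass at the empty tuple matches [intRd] in dimension 0. *)
Fixpoint lebRd (R : realType) (n : nat) {struct n} :
    {sigma_finite_measure set (n.-tuple R) -> \bar R} :=
  match n with
  | 0 => [the {sigma_finite_measure set (0.-tuple R) -> \bar R} of \d_([tuple] : 0.-tuple R)]
  | n'.+1 => [the {sigma_finite_measure set (n'.+1.-tuple R) -> \bar R} of lebRdS (lebRd R n')]
  end.

(** * Iterated integrals, products and affine changes of variables *)

Section intRdE.
Context (R : realType).

Lemma intRd_lebRd n (f : n.-tuple R -> \bar R) :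
  measurable_fun setT f -> (forall x, 0 <= f x)%E ->
  intRd f = (\int[lebRd R n]_x f x)%E.
Proof.
elim: n f => [|n IH] f mf f0 /=.
  by rewrite integral_dirac//= diracE in_setT mul1e.
rewrite ge0_integral_pushforward//=; last exact: measurable_consRd.
have mf' : measurable_fun setT (f \o @consRd R n).
  by apply: measurableT_comp => //; exact: measurable_consRd.
rewrite preimage_setT fubini_tonelli1//=.
apply: eq_integral => x _; rewrite IH//.
exact: (measurableT_comp mf' (pair1_measurable x)).
Qed.

(** A signed integral is by definition the difference of the integrals of the positive and negative
    parts, and Tonelli gives the measurability of each. *)
Lemma measurable_integral_param d1 d2 (T1 : measurableType d1) (T2 : measurableType d2)
    (m : {sigma_finite_measure set T2 -> \bar R}) (f : T1 * T2 -> \bar R) :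
  measurable_fun setT f -> measurable_fun setT (fun x => \int[m]_y f (x, y))%E.
Proof.
move=> mf.
rewrite (_ : (fun x => _) = (fun x => \int[m]_y f^\+ (x, y) - \int[m]_y f^\- (x, y))%E).
  apply: emeasurable_funB.
    by apply: (measurable_fun_fubini_tonelli_F f^\+%E) => //; exact: measurable_funepos.
  by apply: (measurable_fun_fubini_tonelli_F f^\-%E) => //; exact: measurable_funeneg.
apply/funext => x; rewrite [LHS]integralE; congr (_ - _)%E; apply: eq_integral => y _.
  by rewrite -[LHS]/((f \o pair x)^\+%E y) funepos_comp.
by rewrite -[LHS]/((f \o pair x)^\-%E y) funeneg_comp.
Qed.

Lemma emeasurable_prod d (T : measurableType d) (I : Type) (s : seq I) (h : I -> T -> \bar R) :
  (forall i, measurable_fun setT (h i)) ->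
  measurable_fun setT (fun x => \prod_(i <- s) h i x)%E.
Proof.
move=> mh; elim: s => [|i s IH].
  by rewrite (_ : (fun x => _) = cst 1%E)//; apply/funext => x; rewrite big_nil.
rewrite (_ : (fun x => _) = (fun x => h i x * \prod_(i <- s) h i x)%E).
  exact: emeasurable_funM.
by apply/funext => x; rewrite big_cons.
Qed.

Lemma measurable_intRd n d (T : measurableType d) (f : T * n.-tuple R -> \bar R) :
  measurable_fun setT f -> measurable_fun setT (fun t => intRd (fun y => f (t, y))).
Proof.
elim: n d T f => [|n IH] d T f mf /=; first exact: (measurableT_comp mf (pair2_measurable _)).
apply: (@measurable_integral_param _ _ _ _ (@lebesgue_measure R)
  (fun z => intRd (fun y => f (z.1, cons_tuple z.2 y)))).
apply: (IH _ _ (fun z => f (z.1.1, cons_tuple z.1.2 z.2))).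
apply: (measurableT_comp mf); apply/measurable_fun_pairP; split.
  exact: (measurableT_comp measurable_fst measurable_fst).
apply: (@measurable_cons _ _ _ R (fun z => z.1.2) n (fun z => z.2)).
  exact: (measurableT_comp measurable_snd measurable_fst).
exact: measurable_snd.
Qed.

(** For the signed cosine and sine integrals that characterise p; Fubini takes the place of
    Tonelli. *)
Lemma intRd_lebRd_integrable n (f : n.-tuple R -> \bar R) :
  (lebRd R n).-integrable setT f ->
  intRd f = (\int[lebRd R n]_x f x)%E.
Proof.
elim: n f => [|n IH] f /= fi.
  have /integrableP[mf _] := fi.
  by rewrite integral_dirac//= diracE in_setT mul1e.
have /integrableP[mf _] := fi.
have mc := @measurable_consRd R n.
have mfc : measurable_fun setT (f \o @consRd R n) by exact: measurableT_comp.
have fi' : (@lebesgue_measure R \x lebRd R n)%E.-integrable setT (f \o @consRd R n).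
  apply/integrableP; split => //.
  have /integrableP[_] := fi.
  by rewrite ge0_integral_pushforward//=; exact: measurableT_comp.
rewrite integral_pushforward//= preimage_setT -integral12_prod_meas1//=.
(* Only almost every slice is integrable, so the induction hypothesis is applied off the null set
   [N]. *)
have := ae_integrable1 fi' => -[N [mN N0 NP]].
apply: ae_eq_integral => //.
- exact: (measurable_intRd (f := f \o @consRd R n)).
- exact: measurable_fubini_F fi'.
exists N; split => // x /= nx; apply: NP => /= h; apply: nx => _.
exact: IH.
Qed.

Lemma integral_lebRd_prod n (h : 'I_n -> R -> \bar R) :
  (forall i, measurable_fun setT (h i)) -> (forall i x, 0 <= h i x)%E ->
  (\int[lebRd R n]_x (\prod_(i < n) h i (tnth x i)) =
   \prod_(i < n) \int[@lebesgue_measure R]_x h i x)%E.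
Proof.
move=> mh h0.
have mp k (h' : 'I_k -> R -> \bar R) : (forall i, measurable_fun setT (h' i)) ->
    measurable_fun setT (fun x : k.-tuple R => \prod_(i < k) h' i (tnth x i))%E.
  move=> mh'; apply: (@emeasurable_prod _ _ _ _ (fun i x => h' i (tnth x i))) => i.
  exact: (measurableT_comp (mh' i) (measurable_tnth i)).
rewrite -intRd_lebRd//; [|exact: mp|by move=> x; apply: prode_ge0].
elim: n h mh h0 => [|n IH] h mh h0 /=.
  by rewrite !big_ord0.
rewrite big_ord_recl.
transitivity (\int[@lebesgue_measure R]_x (h ord0 x *
   \prod_(i < n) \int[@lebesgue_measure R]_x0 h (lift ord0 i) x0))%E.
  apply: eq_integral => x _; rewrite -IH//.
  rewrite !intRd_lebRd//.
  - rewrite -ge0_integralZl//; last 2 first.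
    + exact: (mp _ (fun i => h (lift ord0 i))).
    + by move=> y _; apply: prode_ge0.
    apply: eq_integral => y _; rewrite big_ord_recl tnth0; congr (_ * _)%E.
    by apply: eq_bigr => i _; rewrite tnthS.
  - exact: (mp _ (fun i => h (lift ord0 i))).
  - by move=> y; apply: prode_ge0.
  - apply: (measurableT_comp (mp _ h mh)).
    apply: (@measurable_cons _ _ _ R (fun=> x) n (fun z => z)) => //.
  - by move=> y; apply: prode_ge0.
rewrite ge0_integralZr//.
  exact: mh.
by apply: prode_ge0 => i _; apply: integral_ge0.
Qed.

(** Uniqueness of Lebesgue measure: [a] times its image under x |-> a x + b gives every half-open
    interval its length. *)
Lemma ge0_integral_affine_pos (a b : R) (f : R -> \bar R) : 0 < a ->
  measurable_fun setT f -> (forall x, 0 <= f x)%E ->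
  (\int[@lebesgue_measure R]_x f (a * x + b)%R =
   a^-1%:E * \int[@lebesgue_measure R]_x f x)%E.
Proof.
move=> a0 mf f0.
have mT : measurable_fun setT (fun x : measurableTypeR R => a * x + b : measurableTypeR R).
  by apply: measurable_funD => //; exact: measurable_funM.
pose nu := measure_function_pushforward__canonical__measure_function_Measure (@lebesgue_measure R) mT.
pose a' := NngNum (ltW a0).
have E A : measurable A -> lebesgue_measure A = mscale a' nu A.
  apply: lebesgue_measure_unique => _ [[u v]] _ <-.
  change (lebesgue_measure `]u, v]%classic = (a%:E * @lebesgue_measure R ((fun x : R => (a * x + b)%R) @^-1` `]u, v]%classic))%E).
  rewrite (_ : _ @^-1` _ = `](u - b) / a, (v - b) / a]%classic); last first.
    apply/seteqP; split => x /=; rewrite !in_itv/= ltr_pdivrMr// ler_pdivlMr//; lra.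
  rewrite !lebesgue_measure_itv/= !lte_fin ltr_pM2r ?invr_gt0// ltrD2r.
  case: ifPn => _; last by rewrite mule0.
  by rewrite -!EFinB -EFinM; congr EFin; field; rewrite gt_eqF.
rewrite [in RHS](@eq_measure_integral _ _ _ setT (mscale a' nu)); last by move=> A mA _; exact: E.
rewrite ge0_integral_mscale//= ge0_integral_pushforward//=.
by rewrite preimage_setT muleA -EFinM mulVf ?gt_eqF// mul1e.
Qed.

Lemma ge0_integral_affine (a b : R) (f : R -> \bar R) : a != 0 ->
  measurable_fun setT f -> (forall x, 0 <= f x)%E ->
  (\int[@lebesgue_measure R]_x f (a * x + b)%R =
   `|a|^-1%:E * \int[@lebesgue_measure R]_x f x)%E.
Proof.
move=> a0 mf f0; have [a_gt0|a_lt0|] := ltrgtP 0 a; last by move=> /esym/eqP; rewrite (negbTE a0).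
  by rewrite gtr0_norm// ge0_integral_affine_pos.
rewrite ltr0_norm//.
have mN : measurable_fun setT (f \o -%R) by apply: measurableT_comp.
have : (\int[@lebesgue_measure R]_x (f \o -%R) x = \int[@lebesgue_measure R]_x f x)%E.
  rewrite -[LHS](@ge0_integral_pushforward _ _ _ _ _ (-%R : measurableTypeR R -> measurableTypeR R) _ _ setT)//.
  by apply: eq_measure_integral => A mA _; exact: lebesgue_measureN.
move=> <-; rewrite -(@ge0_integral_affine_pos (- a) (- b))//.
- by apply: eq_integral => x _ /=; congr f; ring.
- by rewrite oppr_gt0.
- by move=> x; exact: f0.
Qed.

(** Serves two purposes: [a = -1] gives the reflected translation [subRd x], and a positive [a] the
    scaling of frequencies. *)
Lemma ge0_integral_lebRd_affine n (a : R) (b : n.-tuple R) (f : n.-tuple R -> \bar R) :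
  a != 0 -> measurable_fun setT f -> (forall x, 0 <= f x)%E ->
  (\int[lebRd R n]_x f [tuple (a * tnth x i + tnth b i)%R | i < n] =
   (`|a|^-1 ^+ n)%:E * \int[lebRd R n]_x f x)%E.
Proof.
move=> a0 mf f0.
have mt k (c : k.-tuple R) : measurable_fun setT (fun x : k.-tuple R => [tuple (a * tnth x i + tnth c i)%R | i < k]).
  apply/measurable_fun_tnthP => i.
  rewrite (_ : _ \o _ = fun x => a * tnth x i + tnth c i); last first.
    by apply/funext => x /=; rewrite tnth_mktuple.
  by apply: measurable_funD => //; apply: measurable_funM => //; exact: measurable_tnth.
have mft := measurableT_comp mf (mt n b).
rewrite -!intRd_lebRd//.
elim: n b f mf f0 {mft} => [|n IH] b f mf f0 /=.
  by rewrite expr0 mul1e; congr f; rewrite [LHS]tuple0.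
have mfx (x : R) : measurable_fun setT (fun y : n.-tuple R => f (cons_tuple x y)).
  apply: (measurableT_comp mf).
  exact: (@measurable_cons _ _ _ R (fun=> x) n (fun z => z)).
transitivity (\int[@lebesgue_measure R]_x ((`|a|^-1 ^+ n)%:E *
    intRd (fun y => f (cons_tuple (a * x + thead b)%R y))))%E.
  apply: eq_integral => x _; rewrite -(IH [tuple of behead b])//.
  congr intRd; apply/funext => y; congr f; apply: eq_from_tnth => i; rewrite tnth_mktuple.
  case: (unliftP ord0 i) => [j ->|->].
    by rewrite !tnthS tnth_mktuple [in tnth b _](tuple_eta b) tnthS.
  by rewrite !tnth0 [in tnth b _](tuple_eta b) tnth0.
have mi : measurable_fun setT (fun x : R => intRd (fun y => f (cons_tuple x y))).
  apply: (measurable_intRd (f := fun z => f (cons_tuple z.1 z.2))).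
  exact: (measurableT_comp mf (measurable_consRd (R:=R) (n:=n))).
have i0 (x : R) : (0 <= intRd (fun y => f (cons_tuple x y)))%E.
  by rewrite intRd_lebRd//; exact: integral_ge0.
rewrite ge0_integralZl//; last first.
  apply: (measurableT_comp mi).
  by apply: measurable_funD => //; exact: measurable_funM.
rewrite (@ge0_integral_affine a (thead b) (fun x => intRd (fun y => f (cons_tuple x y))))//.
by rewrite muleA -EFinM -exprSr.
Qed.

Lemma ge0_integral_lebRd_subRd n (x : n.-tuple R) (f : n.-tuple R -> \bar R) :
  measurable_fun setT f -> (forall x, 0 <= f x)%E ->
  (\int[lebRd R n]_y f (subRd x y) = \int[lebRd R n]_y f y)%E.
Proof.
move=> mf f0; rewrite -[RHS]mul1e -[X in (X%:E * _)%E](expr1n R n).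
rewrite -[X in (X ^+ n)%:E](invr1 R) -(@normrN1 R) -(@ge0_integral_lebRd_affine _ _ x)//.
  by apply: eq_integral => y _; congr f; apply: eq_from_tnth => i; rewrite !tnth_mktuple mulN1r addrC.
Qed.
End intRdE.

(** * Poisson kernels on the line *)

Section one_dim.
Context (R : realType).
Implicit Types (a b e w s x z : R).

Lemma is_derive_mulrl a s : is_derive s 1 (fun x : R => a * x) a.
Proof.
have := @is_deriveZ _ _ _ id a s 1 1 (is_derive_id _ _).
by rewrite [a *: 1]mulr1.
Qed.

Lemma is_derive_expRM a s : is_derive s 1 (fun x : R => expR (a * x)) (a * expR (a * s)).
Proof.
have := @is_derive1_comp R (@expR R) (fun x : R => a * x) s _ _ (is_derive_expR (a * s)) (is_derive_mulrl a s).
by rewrite mulrC.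
Qed.

Lemma is_derive_sinM a s : is_derive s 1 (fun x : R => sin (a * x)) (a * cos (a * s)).
Proof.
have := @is_derive1_comp R (@sin R) (fun x : R => a * x) s _ _ (is_derive_sin (a * s)) (is_derive_mulrl a s).
by rewrite mulrC.
Qed.

Lemma is_derive_cosM a s : is_derive s 1 (fun x : R => cos (a * x)) (- (a * sin (a * s))).
Proof.
have := @is_derive1_comp R (@cos R) (fun x : R => a * x) s _ _ (is_derive_cos (a * s)) (is_derive_mulrl a s).
by rewrite mulrC mulrN.
Qed.

Lemma is_derive_continuous (f df : R -> R) : (forall s, is_derive s 1 f (df s)) -> continuous f.
Proof.
by move=> dfE s; apply: differentiable_continuous; apply/derivable1_diffP; have [] := dfE s.
Qed.

(** Adding 1 to the cosine makes the integrand nonnegative, as the half-line fundamental theorem and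
    the symmetry lemma demand; the cosine integral is recovered later by subtraction. *)
Let expcos e w s := expR (- `|e * s|) * (1 + cos (w * s)).

Lemma cvgy_expRN e : 0 < e -> expR (- e * s) @[s --> +oo] --> (0 : R).
Proof.
move=> e0; have H : e * s @[s --> +oo] --> +oo; last first.
  have := cvg_comp (fun s => e * s) (fun s => expR (- s)) H (@cvgr_expR R).
  by rewrite (_ : _ \o _ = fun s => expR (- e * s))//; apply/funext => x /=; rewrite mulNr.
apply/cvgryPge => A; near=> x.
rewrite -ler_pdivrMl//; near: x; exact: nbhs_pinfty_ge.
Unshelve. all: by end_near. Qed.

Lemma integral0y_expcos e w : 0 < e ->
  (\int[@lebesgue_measure R]_(s in `[0%R, +oo[) (expcos e w s)%:E =
   (e^-1 + e / (e ^+ 2 + w ^+ 2))%:E)%E.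
Proof.
move=> e0.
have ew : e ^+ 2 + w ^+ 2 != 0 by rewrite gt_eqF// ltr_pwDl// ?exprn_gt0// sqr_ge0.
pose f s := expR (- e * s) * (1 + cos (w * s)).
(* Primitive of [f]: the sine and cosine terms come from exp(-e s) cos(w s), the term -1/e from
   exp(-e s). *)
pose F s := expR (- e * s) * ((w * sin (w * s) - e * cos (w * s)) / (e ^+ 2 + w ^+ 2) - e^-1).
have dF s : is_derive s 1 F (f s).
  have d1 := is_derive_expRM (- e) s.
  have d2 := is_deriveZ w (is_derive_sinM w s).
  have d3 := is_deriveZ e (is_derive_cosM w s).
  have d4 := is_deriveZ (e ^+ 2 + w ^+ 2)^-1 (is_deriveB d2 d3).
  have d5 := is_deriveB d4 (is_derive_cst (e^-1) s 1).
  have d6 := is_deriveM d1 d5.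
  move: d6; rewrite (_ : _ * _ = F); last first.
    by apply/funext => x; rewrite /F [in RHS](mulrC _ (_^-1)).
  move=> d6; apply: DeriveDef; first by have [] := d6.
  have [_ ->] := d6; rewrite !fctE /f /GRing.scale/=; rewrite /GRing.scale/= ?/GRing.scale/=.
  move: (sin _) (cos _) (expR _) => S C X; field.
  by rewrite ew gt_eqF.
transitivity (\int[@lebesgue_measure R]_(s in `[0%R, +oo[) (f s)%:E)%E.
  apply: eq_integral => s; rewrite inE/= in_itv/= andbT => s0.
  by rewrite /expcos/f ger0_norm ?mulNr// mulr_ge0// ltW.
have cF : continuous F.
  exact: (is_derive_continuous dF).
have cf : continuous f.
  move=> s; apply: cvgM.
    exact: (is_derive_continuous (is_derive_expRM (- e))).
  apply: cvgD; first exact: cvg_cst.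
  exact: (is_derive_continuous (is_derive_cosM w)).
rewrite (@ge0_continuous_FTC2y _ f F 0 0).
- rewrite sub0e -EFinN; congr EFin; rewrite /F !mulr0 expR0 sin0 cos0; field.
  by rewrite ew gt_eqF.
- by move=> s _; rewrite mulr_ge0 ?expR_ge0//; have := cos_geN1 (w * s); lra.
- exact: continuous_subspaceT.
- pose C := (`|w| + e) / (e ^+ 2 + w ^+ 2) + e^-1.
  have C0 : 0 <= C by rewrite addr_ge0 ?invr_ge0 ?(ltW e0)// divr_ge0 ?addr_ge0 ?sqr_ge0// ltW.
  have cC : expR (- e * s) * C @[s --> +oo] --> 0.
    by rewrite -(mul0r C); apply: cvgM; [exact: cvgy_expRN|exact: cvg_cst].
  have cNC : - (expR (- e * s) * C) @[s --> +oo] --> 0 by rewrite -oppr0; exact: cvgN.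
  apply: (squeeze_cvgr _ cNC cC); near=> s.
  rewrite -ler_norml /F normrM ger0_norm ?expR_ge0// ler_wpM2l ?expR_ge0//.
  rewrite (le_trans (ler_normB _ _))// lerD//; last by rewrite ger0_norm// invr_ge0 ltW.
  rewrite normrM [`|_^-1|]ger0_norm ?invr_ge0 ?addr_ge0 ?sqr_ge0//.
  rewrite ler_wpM2r ?invr_ge0 ?addr_ge0 ?sqr_ge0//.
  rewrite (le_trans (ler_normB _ _))// !normrM (gtr0_norm e0) lerD// ?ler_piMr// ?sin_max ?cos_max//.
  by rewrite ltW.
- by move=> s _; have [] := dF s.
- exact/cvg_at_right_filter/cF.
- by move=> s _; rewrite derive1E; exact: derive_val.
Unshelve. all: by end_near. Qed.

Lemma continuous_expcos e w : continuous (expcos e w).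
Proof.
move=> s; apply: cvgM.
  apply: (@continuous_comp _ _ _ (fun s => - `|e * s|) (@expR R)); last exact: continuous_expR.
  apply: cvgN; apply: (@continuous_comp _ _ _ (fun s => e * s) (fun x : R => `|x|)); last exact: norm_continuous.
  by apply: cvgM; [exact: cvg_cst|exact: cvg_id].
apply: cvgD; first exact: cvg_cst.
exact: (is_derive_continuous (is_derive_cosM w)).
Qed.

Lemma expcos_ge0 e w s : 0 <= expcos e w s.
Proof.
by rewrite mulr_ge0 ?expR_ge0//; have := cos_geN1 (w * s); lra.
Qed.

Lemma integral_expcos e w : 0 < e ->
  (\int[@lebesgue_measure R]_s (expcos e w s)%:E =
   (2 / e + 2 * e / (e ^+ 2 + w ^+ 2))%:E)%E.
Proof.
move=> e0; rewrite ge0_symfun_integralT.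
- rewrite (_ : [set x | 0 <= x] = `[0, +oo[%classic); last first.
    by apply/seteqP; split => x /=; rewrite in_itv/= andbT.
  by rewrite integral0y_expcos// -EFinM; congr EFin; rewrite mulrDr mulrA.
- exact: expcos_ge0.
- exact: continuous_expcos.
- by move=> s /=; rewrite /expcos !mulrN normrN cosN.
Qed.

Lemma measurable_expRN_norm e : measurable_fun setT (fun s : R => expR (- `|e * s|)).
Proof.
apply: measurableT_comp => //; apply: measurableT_comp => //.
by apply: measurableT_comp => //; exact: measurable_funM.
Qed.

(** At [w = 0] the integrand [expcos] is twice this exponential. *)
Lemma integral_expRN_norm e : 0 < e ->
  (\int[@lebesgue_measure R]_s (expR (- `|e * s|))%:E = (2 / e)%:E)%E.
Proof.
move=> e0; have := integral_expcos 0 e0.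
have -> : (\int[@lebesgue_measure R]_s (expcos e 0 s)%:E =
    2%:E * \int[@lebesgue_measure R]_s (expR (- `|e * s|))%:E)%E.
  rewrite -ge0_integralZl//; last by apply/measurable_EFinP; exact: measurable_expRN_norm.
  by apply: eq_integral => s _; rewrite -EFinM /expcos mul0r cos0 mulrC.
case: (\int[_]_s _)%E => [r| |]//.
  by rewrite -EFinM => -[] H; congr EFin; apply: (@mulfI _ 2) => //; rewrite H; field; rewrite gt_eqF.
  by rewrite mulry gtr0_sg// mul1e.
by rewrite mulrNy gtr0_sg// mul1e.
Qed.

Lemma integrable_expRN_norm e : 0 < e ->
  (@lebesgue_measure R).-integrable setT (fun s => (expR (- `|e * s|))%:E).
Proof.
move=> e0; apply/integrableP; split; first by apply/measurable_EFinP; exact: measurable_expRN_norm.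
have -> : (\int[@lebesgue_measure R]_s `|(expR (- `|e * s|))%:E| = (2 / e)%:E)%E; last exact: ltry.
rewrite -integral_expRN_norm//; apply: eq_integral => s _.
by rewrite abse_EFin ger0_norm// expR_ge0.
Qed.

Lemma integrable_expRN_normM e (h : R -> R) : 0 < e -> measurable_fun setT h ->
  (forall s, `|h s| <= 1) ->
  (@lebesgue_measure R).-integrable setT (fun s => (expR (- `|e * s|) * h s)%:E).
Proof.
move=> e0 mh h1; apply: le_integrable (integrable_expRN_norm e0) => //.
  by apply/measurable_EFinP; apply: measurable_funM => //; exact: measurable_expRN_norm.
by move=> s _; rewrite /= lee_fin normrM ler_piMr.
Qed.

Lemma measurable_cosM w : measurable_fun setT (fun s : R => cos (w * s)).
Proof. apply: (@measurableT_comp _ _ _ _ _ _ (@cos R)); last exact: measurable_funM.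
by apply: continuous_measurable_fun; exact: continuous_cos. Qed.

Lemma measurable_sinM w : measurable_fun setT (fun s : R => sin (w * s)).
Proof. apply: (@measurableT_comp _ _ _ _ _ _ (@sin R)); last exact: measurable_funM.
by apply: continuous_measurable_fun; exact: continuous_sin. Qed.

Lemma integral_expRN_norm_cos e w : 0 < e ->
  (\int[@lebesgue_measure R]_s (expR (- `|e * s|) * cos (w * s))%:E =
   (2 * e / (e ^+ 2 + w ^+ 2))%:E)%E.
Proof.
move=> e0; have := integral_expcos w e0.
have -> : (\int[@lebesgue_measure R]_s (expcos e w s)%:E =
    \int[@lebesgue_measure R]_s ((expR (- `|e * s|))%:E + (expR (- `|e * s|) * cos (w * s))%:E))%E.
  by apply: eq_integral => s _; rewrite -EFinD /expcos mulrDr mulr1.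
rewrite integralD//; last 2 first.
- exact: integrable_expRN_norm.
- apply: integrable_expRN_normM => //; [exact: measurable_cosM|by move=> s; exact: cos_max].
rewrite integral_expRN_norm//; case: (X in (_ + X)%E) => [r| |]//.
by rewrite -EFinD => -[] /addrI ->.
Qed.

(** The integrand is odd: its negative part is the reflection of its positive part, so the two
    integrals are equal, and finite. *)
Lemma integral_expRN_norm_sin e w : 0 < e ->
  (\int[@lebesgue_measure R]_s (expR (- `|e * s|) * sin (w * s))%:E = 0)%E.
Proof.
move=> e0; pose f s : \bar R := (expR (- `|e * s|) * sin (w * s))%:E.
have fi : (@lebesgue_measure R).-integrable setT f.
  apply: integrable_expRN_normM => //; [exact: measurable_sinM|by move=> s; exact: sin_max].
have /integrableP[mf _] := fi.
have mfp : measurable_fun setT f^\+%E by exact: measurable_funepos.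
have E : f^\-%E = (fun s => f^\+%E (-1 * s + 0)).
  rewrite -funeposN (_ : (\- f)%E = f \o (fun s => -1 * s + 0)); first by rewrite funepos_comp.
  by apply/funext => s; rewrite /f/= addr0 mulN1r !mulrN normrN sinN mulrN.
rewrite integralE E ge0_integral_affine ?oppr_eq0 ?oner_eq0//.
rewrite normrN1 invr1 mul1e subee//.
exact: integrable_pos_fin_num.
Qed.

Lemma integral_expRN_norm_cosD e w c : 0 < e ->
  (\int[@lebesgue_measure R]_s (expR (- `|e * s|) * cos (c + w * s))%:E =
   (cos c * (2 * e / (e ^+ 2 + w ^+ 2)))%:E)%E.
Proof.
move=> e0.
have i1 : (@lebesgue_measure R).-integrable setT (fun s => (expR (- `|e * s|) * cos (w * s))%:E).
  by apply: integrable_expRN_normM => //; [exact: measurable_cosM|move=> s; exact: cos_max].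
have i2 : (@lebesgue_measure R).-integrable setT (fun s => (expR (- `|e * s|) * sin (w * s))%:E).
  by apply: integrable_expRN_normM => //; [exact: measurable_sinM|move=> s; exact: sin_max].
transitivity (\int[@lebesgue_measure R]_s ((cos c)%:E * (expR (- `|e * s|) * cos (w * s))%:E
    - (sin c)%:E * (expR (- `|e * s|) * sin (w * s))%:E))%E.
  by apply: eq_integral => s _; rewrite -!EFinM -EFinB cosD; congr EFin; ring.
rewrite integralB//; last 2 first.
- exact: integrableZl.
- exact: integrableZl.
rewrite !integralZl// integral_expRN_norm_cos// integral_expRN_norm_sin// mule0 sube0.
by rewrite EFinM.
Qed.

Lemma integral_poisson_itv e a b x : 0 < e -> a < b ->
  (\int[@lebesgue_measure R]_(z in `]a, b[) (2 * e / (e ^+ 2 + (x - z) ^+ 2))%:E =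
   (2 * (atan ((b - x) / e) - atan ((a - x) / e)))%:E)%E.
Proof.
move=> e0 ab.
pose F z := 2 * atan (e^-1 * (z - x)).
pose f z := 2 * e / (e ^+ 2 + (x - z) ^+ 2).
have ez z : e ^+ 2 + (x - z) ^+ 2 != 0 by rewrite gt_eqF// ltr_pwDl// ?exprn_gt0// sqr_ge0.
have dF z : is_derive z 1 F (f z).
  have d1 := is_deriveZ e^-1 (is_deriveB (is_derive_id z 1) (is_derive_cst x z 1)).
  have d2 := is_deriveZ 2 (@is_derive1_comp R (@atan R) _ z _ _ (is_derive1_atan _) d1).
  apply: DeriveDef; first by have [] := d2.
  have [_ ->] := d2; rewrite !fctE /f /GRing.scale/=; rewrite /GRing.scale/= ?/GRing.scale/=.
  have ez' : e ^+ 2 + (z - x) ^+ 2 != 0 by rewrite (_ : z - x = - (x - z)) ?sqrrN ?ez//; ring.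
  have ex' : 1 + (e^-1 * (z - x)) ^+ 2 != 0.
    by rewrite gt_eqF// ltr_pwDl// sqr_ge0.
  field.
  by rewrite ez gt_eqF.
have cF : continuous F.
  exact: (is_derive_continuous dF).
have cf : continuous f.
  move=> s; apply: cvgM; first exact: cvg_cst.
  apply: cvgV; first exact: ez.
  apply: cvgD; first exact: cvg_cst.
  by apply: cvgM; apply: cvgB; (exact: cvg_cst || exact: cvg_id).
rewrite -(@integral_itv_bndoo _ _ _ _ true false); last first.
  by apply: measurable_funTS; apply/measurable_EFinP; exact: continuous_measurable_fun.
rewrite (@continuous_FTC2 _ f F a b)//.
- rewrite -EFinB; congr EFin; rewrite /F -mulrBr.
  by congr (2 * (atan _ - atan _)); exact: mulrC.
- exact: continuous_subspaceT.
- split.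
  + by move=> z _; have [] := dF z.
  + exact/cvg_at_right_filter/cF.
  + exact/cvg_at_left_filter/cF.
- by move=> z _; rewrite derive1E; exact: derive_val.
Qed.

(** The kernel has total mass 2 pi and concentrates at x. At an endpoint only half of the mass would
    remain, hence the exclusion of a and b. *)
Lemma cvg_poisson_itv a b x : x != a -> x != b -> a < b ->
  2 * (atan ((b - x) / n.+1%:R^-1) - atan ((a - x) / n.+1%:R^-1)) @[n --> \oo] -->
  (2 * pi * (x \in `]a, b[)%:R : R).
Proof.
have A (y : R) : y != 0 -> atan (y / n.+1%:R^-1) @[n --> \oo] --> Num.sg y * (pi / 2).
  wlog y0 : y / 0 < y => [H|] y_neq0.
    have [y0|y0|] := ltrgtP 0 y; [exact: H| |by move/eqP; rewrite eq_sym (negbTE y_neq0)].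
    rewrite -[y]opprK sgrN mulNr.
    under eq_cvg do rewrite mulNr atanN.
    by apply: cvgN; apply: H; rewrite ?oppr_gt0// oppr_eq0.
  rewrite gtr0_sg// mul1r.
  apply: (cvg_comp _ _ _ (@cvgy_atan R)).
  apply/cvgryPge => M; near=> n.
  rewrite invrK -ler_pdivrMl// (le_trans (y := n%:R))// ?ler_nat//.
  near: n; exact: nbhs_infty_ger.
move=> xa xb ab.
have -> : 2 * pi * (x \in `]a, b[)%:R = 2 * (Num.sg (b - x) * (pi / 2) - Num.sg (a - x) * (pi / 2)) :> R.
  rewrite in_itv/=; have [ax|ax|/eqP] := ltrgtP a x; last by rewrite eq_sym (negbTE xa).
    rewrite [Num.sg (a - x)]ltr0_sg ?subr_lt0//.
    have [bx|bx|/eqP] := ltrgtP x b; last by rewrite (negbTE xb).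
      by rewrite gtr0_sg ?subr_gt0//=; lra.
    by rewrite ltr0_sg ?subr_lt0//=; lra.
  by rewrite [Num.sg (a - x)]gtr0_sg ?subr_gt0// gtr0_sg ?subr_gt0 ?(lt_trans ax)//=; lra.
apply: cvgM; first exact: cvg_cst.
by apply: cvgB; apply: A; rewrite subr_eq0 eq_sym.
Unshelve. all: by end_near. Qed.
End one_dim.

(** * Fourier inversion on boxes *)

Section fourier_tuple.
Context (R : realType).
Implicit Types (e c : R).

(** This is exp(-e |xi|_1): the l1 norm makes the damping factor a product over coordinates. *)
Definition expRd d e (xi : d.-tuple R) : R := \prod_(i < d) expR (- `|e * tnth xi i|).

(** The Fourier transform of [expRd e], left unnormalised: its total mass (2 pi)^d is the origin of
    that constant below. *)
Definition poissonRd d e (w : d.-tuple R) : R :=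
  \prod_(i < d) (2 * e / (e ^+ 2 + tnth w i ^+ 2)).

Lemma measurable_tuple_prod d (h : 'I_d -> R -> R) : (forall i, measurable_fun setT (h i)) ->
  measurable_fun setT (fun x : d.-tuple R => \prod_(i < d) h i (tnth x i)).
Proof.
move=> mh; apply: measurable_prod => i _.
exact: (measurableT_comp (mh i) (measurable_tnth i)).
Qed.

Lemma cvg_prodr (I : Type) (s : seq I) (f : I -> nat -> R) (l : I -> R) :
  (forall i, f i n @[n --> \oo] --> l i) ->
  \prod_(i <- s) f i n @[n --> \oo] --> \prod_(i <- s) l i.
Proof.
move=> fl; elim: s => [|i s IH].
  by rewrite big_nil; under eq_fun do rewrite big_nil; exact: cvg_cst.
by rewrite big_cons; under eq_fun do rewrite big_cons; exact: cvgM.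
Qed.

Lemma cvg_expRd d (xi : d.-tuple R) : \prod_(i < d) expR (- `|n.+1%:R^-1 * tnth xi i|) @[n --> \oo] --> (1 : R).
Proof.
suff : \prod_(i < d) expR (- `|n.+1%:R^-1 * tnth xi i|) @[n --> \oo] --> \prod_(i < d) (1 : R).
  by rewrite big1_eq.
apply: (@cvg_prodr _ _ (fun i n => expR (- `|n.+1%:R^-1 * tnth xi i|)) (fun=> 1)) => i.
have H : n.+1%:R^-1 * tnth xi i @[n --> \oo] --> 0.
  by rewrite -(mul0r (tnth xi i)); apply: cvgM; [exact: cvg_harmonic|exact: cvg_cst].
suff : expR (- `|n.+1%:R^-1 * tnth xi i|) @[n --> \oo] --> expR (- `|0 : R|).
  by rewrite normr0 oppr0 expR0.
apply: continuous_cvg; first exact: continuous_expR.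
by apply: cvgN; exact: cvg_norm.
Qed.

Lemma measurable_expRd d e : measurable_fun setT (@expRd d e).
Proof. by apply: (@measurable_tuple_prod d (fun=> fun s => expR (- `|e * s|))) => i; exact: measurable_expRN_norm. Qed.

Lemma expRd_ge0 d e xi : 0 <= @expRd d e xi.
Proof. by apply: prodr_ge0 => i _; exact: expR_ge0. Qed.

Lemma expRd_le1 d e xi : @expRd d e xi <= 1.
Proof.
apply: prodr_ile1 => i _; rewrite expR_ge0/= -expR0 ler_expR oppr_le0; exact: normr_ge0.
Qed.

Lemma measurable_dotRd d (xi : d.-tuple R) : measurable_fun setT (fun x => dotRd xi x).
Proof.
apply: measurable_sum => i; apply: measurable_funM => //; exact: measurable_tnth.
Qed.

Lemma measurable_dotRd2 d : measurable_fun setT (fun z : d.-tuple R * d.-tuple R => dotRd z.1 z.2).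
Proof.
apply: measurable_sum => i; apply: measurable_funM.
  exact: (measurableT_comp (measurable_tnth i) measurable_fst).
exact: (measurableT_comp (measurable_tnth i) measurable_snd).
Qed.

Lemma dotRdC d (x y : d.-tuple R) : dotRd x y = dotRd y x.
Proof. by apply: eq_bigr => i _; rewrite mulrC. Qed.

Lemma dotRd_sub d (x y z : d.-tuple R) : dotRd x (subRd y z) = dotRd x y - dotRd x z.
Proof.
by rewrite /dotRd -sumrB; apply: eq_bigr => i _; rewrite tnth_mktuple mulrBr.
Qed.

Lemma dotRd_cons d (x y : R) (x' y' : d.-tuple R) :
  dotRd (cons_tuple x x') (cons_tuple y y') = x * y + dotRd x' y'.
Proof.
rewrite /dotRd big_ord_recl !tnth0; congr (_ + _).
by apply: eq_bigr => i _; rewrite !tnthS.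
Qed.

Lemma integrable_expRd d e : 0 < e ->
  (lebRd R d).-integrable setT (fun xi => (expRd e xi)%:E).
Proof.
move=> e0; apply/integrableP; split; first by apply/measurable_EFinP; exact: measurable_expRd.
have -> : (\int[lebRd R d]_x `|(expRd e x)%:E| =
    \int[lebRd R d]_x \prod_(i < d) (expR (- `|e * tnth x i|))%:E)%E.
  apply: eq_integral => x _; rewrite abse_EFin ger0_norm ?expRd_ge0//.
  by rewrite /expRd prodEFin.
rewrite (@integral_lebRd_prod R d (fun _ s => (expR (- `|e * s|))%:E)).
- under eq_bigr do rewrite integral_expRN_norm//.
  by rewrite prodEFin ltry.
- by move=> i; apply/measurable_EFinP; exact: measurable_expRN_norm.
- by move=> i s; rewrite lee_fin expR_ge0.
Qed.

Lemma integrable_expRd_cos d e c (w : d.-tuple R) : 0 < e ->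
  (lebRd R d).-integrable setT (fun xi => (expRd e xi * cos (c + dotRd xi w))%:E).
Proof.
move=> e0; apply: le_integrable (integrable_expRd d e0) => //.
  apply/measurable_EFinP; apply: measurable_funM; first exact: measurable_expRd.
  apply: (@measurableT_comp _ _ _ _ _ _ (@cos R)).
    by apply: continuous_measurable_fun; exact: continuous_cos.
  apply: measurable_funD => //; under eq_fun do rewrite dotRdC; exact: measurable_dotRd.
by move=> s _; rewrite /= lee_fin normrM ler_piMr// cos_max.
Qed.

(* The phase c is what makes the induction on the dimension go through. *)
Lemma integral_expRd_cos d e c (w : d.-tuple R) : 0 < e ->
  (\int[lebRd R d]_xi (expRd e xi * cos (c + dotRd xi w))%:E =
   (cos c * poissonRd e w)%:E)%E.
Proof.
move=> e0; rewrite -intRd_lebRd_integrable; last exact: integrable_expRd_cos.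
elim: d c w => [|d IH] c w /=.
  by rewrite /expRd /dotRd /poissonRd !big_ord0 mul1r addr0 mulr1.
pose w0 := thead w; pose w' := [tuple of behead w].
have wE : w = cons_tuple w0 w' by rewrite [LHS](tuple_eta w); apply: val_inj.
transitivity (\int[@lebesgue_measure R]_s ((poissonRd e w')%:E * (expR (- `|e * s|) * cos (c + w0 * s))%:E))%E.
  apply: eq_integral => s _.
  transitivity (intRd (fun y : d.-tuple R => (expR (- `|e * s|))%:E * (expRd e y * cos (c + s * w0 + dotRd y w'))%:E)%E).
    congr intRd; apply/funext => y; rewrite -EFinM; congr EFin.
    rewrite wE dotRd_cons addrA mulrA; congr (_ * _).
    by rewrite /expRd big_ord_recl tnth0; congr (_ * _); apply: eq_bigr => i _; rewrite tnthS.
  rewrite intRd_lebRd_integrable; last by apply: integrableZl => //; exact: integrable_expRd_cos.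
  rewrite integralZl//; last exact: integrable_expRd_cos.
  rewrite -intRd_lebRd_integrable; last exact: integrable_expRd_cos.
  by rewrite IH -!EFinM; congr EFin; rewrite [s * w0]mulrC; ring.
rewrite integralZl//; last first.
  apply: integrable_expRN_normM => //; last by move=> s; exact: cos_max.
  apply: (@measurableT_comp _ _ _ _ _ _ (@cos R)).
    by apply: continuous_measurable_fun; exact: continuous_cos.
  by apply: measurable_funD => //; exact: measurable_funM.
rewrite integral_expRN_norm_cosD// -EFinM; congr EFin.
rewrite [in RHS]wE /poissonRd big_ord_recl tnth0.
under [in RHS]eq_bigr do rewrite tnthS.
by rewrite mulrCA; congr (cos c * _); exact: mulrC.
Qed.

Lemma poissonRd_ge0 d e (w : d.-tuple R) : 0 <= e -> 0 <= poissonRd e w.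
Proof.
move=> e0; apply: prodr_ge0 => i _.
by rewrite divr_ge0 ?mulr_ge0// addr_ge0// sqr_ge0.
Qed.

End fourier_tuple.

Section inversion.
Context (R : realType) (d : nat) (P E : d.-tuple R -> R).
Hypotheses (mP : measurable_fun setT P) (P0 : forall x, 0 <= P x).
Hypothesis (Pi : (lebRd R d).-integrable setT (EFin \o P)).
Hypotheses (E0 : forall xi, 0 <= E xi).
Hypothesis (Ei : (lebRd R d).-integrable setT (EFin \o E)).
(** The phase packs both parts of the Fourier transform into one identity: c = 0 gives the real part
    E, and c = -pi/2 says that the imaginary part vanishes. *)
Hypothesis (HE : forall (xi : d.-tuple R) c,
  (\int[lebRd R d]_x (P x * cos (dotRd xi x + c))%:E = (E xi * cos c)%:E)%E).

Let mE : measurable_fun setT E.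
Proof. by have /integrableP[/measurable_EFinP] := Ei. Qed.

Let mcos : measurable_fun setT (@cos R).
Proof. by apply: continuous_measurable_fun; exact: continuous_cos. Qed.

Lemma integrable_mul_cos (f : d.-tuple R -> R) (g : d.-tuple R -> R) :
  (lebRd R d).-integrable setT (EFin \o f) -> measurable_fun setT g ->
  (forall x, `|g x| <= 1) ->
  (lebRd R d).-integrable setT (fun x => (f x * g x)%:E).
Proof.
move=> fi mg g1; have /integrableP[/measurable_EFinP mf _] := fi.
apply: le_integrable fi => //.
  by apply/measurable_EFinP; exact: measurable_funM.
by move=> x _; rewrite /= lee_fin normrM ler_piMr.
Qed.

(** Write the Poisson kernel as the Fourier integral of [expRd e] and exchange the two integrals;
    [HE] is then used with the phase -xi.z. *)
Lemma poisson_convolution (e : R) (z : d.-tuple R) : 0 < e ->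
  (\int[lebRd R d]_x (P x * poissonRd e (subRd x z))%:E =
   \int[lebRd R d]_xi (E xi * (expRd e xi * cos (dotRd xi z)))%:E)%E.
Proof.
move=> e0.
pose F (w : d.-tuple R * d.-tuple R) : \bar R :=
  (P w.1 * (expRd e w.2 * cos (dotRd w.2 (subRd w.1 z))))%:E.
have mF : measurable_fun setT F.
  apply/measurable_EFinP; apply: measurable_funM; first exact: (measurableT_comp mP measurable_fst).
  apply: measurable_funM; first exact: (measurableT_comp (measurable_expRd e) measurable_snd).
  apply: (measurableT_comp mcos); under eq_fun do rewrite dotRd_sub.
  apply: measurable_funB.
    under eq_fun do rewrite dotRdC; exact: measurable_dotRd2.
  under eq_fun do rewrite dotRdC; exact: (measurableT_comp (measurable_dotRd z) measurable_snd).
have mFa : measurable_fun setT (abse \o F) by exact: measurableT_comp.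
have Fi : (lebRd R d \x lebRd R d)%E.-integrable setT F.
  apply/integrable12ltyP => //.
  (* The damping makes the double integral absolutely convergent: |F| is at most P(x) times
     [expRd e xi], a product of integrable functions. *)
  apply: (@le_lt_trans _ _ (\int[lebRd R d]_x ((P x)%:E * \int[lebRd R d]_xi (expRd e xi)%:E))%E).
    apply: ge0_le_integral => //.
    - by move=> x _; apply: integral_ge0.
    - exact: (measurable_integral_param (lebRd R d) mFa).
    - apply: emeasurable_funM => //; exact/measurable_EFinP.
    move=> x _; rewrite -ge0_integralZl//; last 3 first.
    - by apply/measurable_EFinP; exact: measurable_expRd.
    - by move=> xi _; rewrite lee_fin expRd_ge0.
    - by rewrite lee_fin.
    apply: ge0_le_integral => //.
    - by apply: measurableT_comp => //; exact: (measurableT_comp mF (pair1_measurable x)).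
    - apply: emeasurable_funM => //; apply/measurable_EFinP; exact: measurable_expRd.
    move=> xi _; rewrite /F/= -EFinM lee_fin !normrM ger0_norm// ler_wpM2l//.
    by rewrite ger0_norm ?expRd_ge0// ler_piMr ?expRd_ge0// cos_max.
  rewrite ge0_integralZr//; last 3 first.
  - exact/measurable_EFinP.
  - by move=> x _; rewrite lee_fin.
  - by apply: integral_ge0 => xi _; rewrite lee_fin expRd_ge0.
  rewrite lte_mul_pinfty//.
  - by apply: integral_ge0 => xi _; rewrite lee_fin.
  - exact: integrable_fin_num.
  - by rewrite -ge0_fin_numE; [exact/integrable_fin_num/integrable_expRd|apply: integral_ge0 => xi _; rewrite lee_fin expRd_ge0].
transitivity (\int[lebRd R d]_x \int[lebRd R d]_xi F (x, xi))%E.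
  apply: eq_integral => x _; rewrite /F/=.
  under eq_integral do rewrite EFinM.
  rewrite integralZl//; last first.
    have := integrable_expRd_cos 0 (subRd x z) e0.
    by under eq_fun do rewrite add0r.
  under [in RHS]eq_integral => xi _ do rewrite -[dotRd xi _]add0r.
  by rewrite integral_expRd_cos// cos0 mul1r EFinM.
rewrite Fubini//; apply: eq_integral => xi _; rewrite /F/=.
transitivity (\int[lebRd R d]_x ((expRd e xi)%:E * (P x * cos (dotRd xi x + (- dotRd xi z)))%:E))%E.
  by apply: eq_integral => x _; rewrite -EFinM dotRd_sub; congr EFin; ring.
rewrite integralZl//; last first.
  apply: integrable_mul_cos => //; last by move=> x; exact: cos_max.
  apply: (measurableT_comp mcos); apply: measurable_funD => //; exact: measurable_dotRd.
by rewrite HE cosN -EFinM; congr EFin; ring.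
Qed.

(** The Fourier inversion integral without its factor (2 pi)^(-d), which reappears in [invF_box]. *)
Definition invF (z : d.-tuple R) : R :=
  fine (\int[lebRd R d]_xi (E xi * cos (dotRd xi z))%:E)%E.

Let mcosd z : measurable_fun setT (fun xi : d.-tuple R => cos (dotRd xi z)).
Proof. apply: (measurableT_comp mcos); under eq_fun do rewrite dotRdC; exact: measurable_dotRd. Qed.

Lemma invFE z : ((invF z)%:E = \int[lebRd R d]_xi (E xi * cos (dotRd xi z))%:E)%E.
Proof.
rewrite fineK//; apply: integrable_fin_num => //; apply: integrable_mul_cos => //.
by move=> x; exact: cos_max.
Qed.

Let M := fine (\int[lebRd R d]_xi (E xi)%:E)%E.

Lemma measurable_invF : measurable_fun setT invF.
Proof.
apply/measurable_EFinP; rewrite (_ : _ \o _ = fun z => \int[lebRd R d]_xi (E xi * cos (dotRd xi z))%:E)%E; last first.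
  by apply/funext => z /=; rewrite invFE.
apply: (@measurable_integral_param _ _ _ _ _ _ (fun w : d.-tuple R * d.-tuple R => (E w.2 * cos (dotRd w.2 w.1))%:E)).
apply/measurable_EFinP; apply: measurable_funM; first exact: (measurableT_comp mE measurable_snd).
by apply: (measurableT_comp mcos); under eq_fun do rewrite dotRdC; exact: measurable_dotRd2.
Qed.

(** A bound free of z and of the smoothing parameter: the constant that dominates the smoothed
    densities on a bounded box. *)
Lemma invF_bound (h : d.-tuple R -> R) : measurable_fun setT h -> (forall xi, `|h xi| <= 1) ->
  (`|\int[lebRd R d]_xi (E xi * h xi)%:E| <= M%:E)%E.
Proof.
move=> mh h1; have mEh : measurable_fun setT (fun xi => (E xi * h xi)%:E).
  by apply/measurable_EFinP; exact: measurable_funM.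
apply: le_trans (le_abse_integral _ measurableT mEh) _.
rewrite /M fineK; last exact: integrable_fin_num.
apply: ge0_le_integral => //.
- exact: measurableT_comp.
- exact/measurable_EFinP.
- by move=> xi _; rewrite lee_fin normrM ger0_norm// ler_piMr.
Qed.

(** On the Fourier side the damping tends to 1 under the integrable majorant E, so convergence holds
    at every z. On the side of P it is exploited only after integration over boxes. *)
Lemma cvg_poisson_convolution z :
  (\int[lebRd R d]_x (P x * poissonRd n.+1%:R^-1 (subRd x z))%:E)%E @[n --> \oo] --> (invF z)%:E.
Proof.
rewrite invFE.
under eq_cvg do rewrite poisson_convolution ?invr_gt0//.
have [] := @dominated_convergence _ _ _ (lebRd R d) setT measurableT
  (fun n xi => (E xi * (expRd n.+1%:R^-1 xi * cos (dotRd xi z)))%:E)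
  (fun xi => (E xi * cos (dotRd xi z))%:E) (EFin \o E).
- move=> n; apply/measurable_EFinP; apply: measurable_funM => //.
  by apply: measurable_funM => //; exact: measurable_expRd.
- by apply/measurable_EFinP; apply: measurable_funM.
- apply: aeW => xi _; apply: cvg_EFin; first exact: nearW.
  rewrite /comp /=; apply: cvgM; first exact: cvg_cst.
  rewrite -[X in _ --> X]mul1r; apply: cvgM; last exact: cvg_cst.
  exact: cvg_expRd.
- by [].
- apply: aeW => xi n _; rewrite lee_fin normrM ger0_norm// ler_piMr// normrM.
  by rewrite mulr_ile1 ?normr_ge0 ?cos_max// ger0_norm ?expRd_ge0 ?expRd_le1.
- by [].
Qed.
End inversion.

(** * Boxes and hyperplanes *)

Section boxes.
Context (R : realType) (d : nat).
Implicit Types a b : 'I_d -> R.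

Definition box a b : set (d.-tuple R) := [set x | forall i, tnth x i \in `]a i, b i[].

Lemma measurable_box a b : measurable (box a b).
Proof.
rewrite (_ : box a b = \bigcap_(i in [set: 'I_d]) ((tnth (T:=R))^~ i @^-1` `]a i, b i[%classic)).
  apply: fin_bigcap_measurable => // i _.
  by rewrite -[X in measurable X]setTI; exact: measurable_tnth.
by apply/seteqP; split => x /= H i; [move=> _; exact: H|exact: (H i I)].
Qed.

Lemma patch_box a b (h : 'I_d -> R -> \bar R) x :
  ((fun x : d.-tuple R => \prod_(i < d) h i (tnth x i))%E \_ (box a b)) x =
  (\prod_(i < d) (h i \_ `]a i, b i[%classic) (tnth x i))%E.
Proof.
rewrite patchE; case: ifPn => [|] xQ.
  apply: eq_bigr => i _; rewrite patchE ifT// inE.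
  by move: xQ; rewrite inE => /(_ i).
have [i xi] : exists i, tnth x i \notin `]a i, b i[.
  apply: contrapT => H; move/negP: xQ; apply; rewrite inE => i.
  by apply: contrapT => /negP ?; apply: H; exists i.
rewrite (bigD1 i)//= patchE ifN ?mul0e//.
by apply/negP; rewrite inE/=; exact/negP.
Qed.

Lemma integral_box_prod a b (h : 'I_d -> R -> \bar R) :
  (forall i, measurable_fun setT (h i)) -> (forall i x, 0 <= h i x)%E ->
  (\int[lebRd R d]_(x in box a b) (\prod_(i < d) h i (tnth x i)) =
   \prod_(i < d) \int[@lebesgue_measure R]_(x in `]a i, b i[) h i x)%E.
Proof.
move=> mh h0; rewrite integral_mkcond.
under eq_integral do rewrite patch_box.
rewrite (@integral_lebRd_prod R d (fun i => h i \_ `]a i, b i[%classic)).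
- by apply: eq_bigr => i _; rewrite [in RHS]integral_mkcond.
- by move=> i; apply/(measurable_restrictT _ _).1 => //; exact: measurable_funTS.
- by move=> i x; rewrite patchE; case: ifP.
Qed.

Lemma lebRd_box a b : (forall i, a i <= b i) ->
  lebRd R d (box a b) = (\prod_(i < d) (b i - a i))%:E.
Proof.
move=> ab; rewrite -[LHS]mul1e -(integral_cst _ (measurable_box a b)).
have -> : (\int[lebRd R d]_(x in box a b) (cst 1) x =
    \int[lebRd R d]_(x in box a b) (\prod_(i < d) (fun=> cst 1) i (tnth x i)))%E.
  by apply: eq_integral => x _; rewrite big1_eq.
rewrite (@integral_box_prod a b (fun=> cst 1%E))//.
rewrite -prodEFin; apply: eq_bigr => i _; rewrite integral_cst//= mul1e lebesgue_measure_itv/=.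
rewrite lte_fin; case: ltP => //= ba.
by have -> : a i = b i; [apply/eqP; rewrite eq_le ab|rewrite subrr].
Qed.

Lemma lebRd_hyperplane (i : 'I_d) c : lebRd R d [set x | tnth x i = c] = 0%E.
Proof.
have mH : measurable [set x : d.-tuple R | tnth x i = c].
  rewrite (_ : [set x | _] = (tnth (T:=R))^~ i @^-1` [set c])//.
  by rewrite -[X in measurable X]setTI; exact: (measurable_tnth i).
rewrite -[LHS]mul1e -(integral_cst _ mH) integral_mkcond.
pose h (j : 'I_d) (s : R) : \bar R := if j == i then (\1_[set c] s)%:E else 1%E.
transitivity (\int[lebRd R d]_x \prod_(j < d) h j (tnth x j))%E.
  apply: eq_integral => x _; rewrite patchE (bigD1 i)//= {1}/h eqxx big1 ?mule1; last first.
    by move=> j ji; rewrite /h (negbTE ji).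
  by rewrite indicE; case: ifPn => [/set_mem /= H|/negP H]; [rewrite mem_set|rewrite memNset// => H'; apply: H; rewrite inE].
rewrite integral_lebRd_prod.
(* The other factors are infinite; the convention that 0 times infinity is 0 concludes. *)
- rewrite (bigD1 i)//= [X in (X * _)%E](_ : _ = 0%E) ?mul0e//.
  by rewrite /h eqxx integral_indic// setIT; exact: lebesgue_measure_set1.
- by move=> j; rewrite /h; case: (j == i) => //; apply/measurable_EFinP; exact: measurable_indic.
- by move=> j s; rewrite /h; case: (j == i) => //; rewrite lee_fin.
Qed.

End boxes.

Section inversion_box.
Context (R : realType) (d : nat) (P E : d.-tuple R -> R).
Hypotheses (mP : measurable_fun setT P) (P0 : forall x, 0 <= P x).
Hypothesis (Pi : (lebRd R d).-integrable setT (EFin \o P)).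
Hypotheses (E0 : forall xi, 0 <= E xi).
Hypothesis (Ei : (lebRd R d).-integrable setT (EFin \o E)).
Hypothesis (HE : forall (xi : d.-tuple R) c,
  (\int[lebRd R d]_x (P x * cos (dotRd xi x + c))%:E = (E xi * cos c)%:E)%E).

Let mcos : measurable_fun setT (@cos R).
Proof. by apply: continuous_measurable_fun; exact: continuous_cos. Qed.

Let e (n : nat) : R := n.+1%:R^-1.
Let e_gt0 n : 0 < e n. Proof. by rewrite invr_gt0. Qed.

Let K (n : nat) (x z : R) : R := 2 * e n / (e n ^+ 2 + (x - z) ^+ 2).

Let K0 n x z : 0 <= K n x z.
Proof. by rewrite divr_ge0 ?mulr_ge0 ?(ltW (e_gt0 n))// addr_ge0// sqr_ge0. Qed.

Let mK2 n : measurable_fun setT (fun w : R * R => K n w.1 w.2).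
Proof.
apply: (@measurableT_comp _ _ _ _ _ _ (fun u : R => 2 * e n / (e n ^+ 2 + u ^+ 2)) _ (fun w : R * R => w.1 - w.2)).
  apply: continuous_measurable_fun => u; apply: cvgM; first exact: cvg_cst.
  apply: cvgV; first by rewrite gt_eqF// ltr_pwDl// ?exprn_gt0// sqr_ge0.
  by apply: cvgD; [exact: cvg_cst|apply: cvgM; exact: cvg_id].
by apply: measurable_funB; [exact: measurable_fst|exact: measurable_snd].
Qed.

Let pE n (x z : d.-tuple R) : poissonRd (e n) (subRd x z) = \prod_(i < d) K n (tnth x i) (tnth z i).
Proof. by apply: eq_bigr => i _; rewrite tnth_mktuple. Qed.

Let mp2 n : measurable_fun setT (fun w : d.-tuple R * d.-tuple R => poissonRd (e n) (subRd w.1 w.2)).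
Proof.
under eq_fun do rewrite pE; apply: measurable_prod => i _.
apply: (measurableT_comp (mK2 n) (g := fun w => (tnth w.1 i, tnth w.2 i))).
apply/measurable_fun_pairP; split.
  exact: (measurableT_comp (measurable_tnth i) measurable_fst).
exact: (measurableT_comp (measurable_tnth i) measurable_snd).
Qed.

Section fix_box.
Variables (a b : 'I_d -> R).
Hypothesis ab : forall i, a i < b i.
Let Q := box a b.
Let mQ : measurable Q. Proof. exact: measurable_box. Qed.

(** The indicator of the box smoothed by the Poisson kernel, evaluated in closed form. *)
Let T (n : nat) (x : d.-tuple R) : R :=
  \prod_(i < d) (2 * (atan ((b i - tnth x i) / e n) - atan ((a i - tnth x i) / e n))).

(** Tonelli moves the smoothing from P to the indicator of the box, where it factors over the
    coordinates. *)
Let smoothed_boxE n :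
  (\int[lebRd R d]_(z in Q) \int[lebRd R d]_x (P x * poissonRd (e n) (subRd x z))%:E =
   \int[lebRd R d]_x (P x * T n x)%:E)%E.
Proof.
rewrite integral_mkcond.
pose F (w : d.-tuple R * d.-tuple R) : \bar R :=
  ((P w.2)%:E * (fun z => (poissonRd (e n) (subRd w.2 z))%:E) \_ Q w.1)%E.
have p0 x z : 0 <= poissonRd (e n) (subRd x z) by apply: poissonRd_ge0; exact: ltW.
have F0 w : (0 <= F w)%E.
  by rewrite /F mule_ge0 ?lee_fin// patchE; case: ifP => // _; rewrite lee_fin.
have mF : measurable_fun setT F.
  apply: emeasurable_funM; first by apply/measurable_EFinP; exact: (measurableT_comp mP measurable_snd).
  rewrite (_ : (fun w => _) = (fun w : d.-tuple R * d.-tuple R => (poissonRd (e n) (subRd w.2 w.1))%:E) \_ (fst @^-1` Q)); last first.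
    by apply/funext => w; rewrite !patchE; congr (if _ then _ else _); apply/idP/idP; rewrite !inE.
  apply/(measurable_restrictT _ _).1.
    by rewrite -[X in measurable X]setTI; exact: measurable_fst.
  apply: measurable_funTS; apply/measurable_EFinP.
  apply: (measurableT_comp (mp2 n) (g := fun w => (w.2, w.1))).
  by apply/measurable_fun_pairP; split; [exact: measurable_snd|exact: measurable_fst].
transitivity (\int[lebRd R d]_z \int[lebRd R d]_x F (z, x))%E.
  apply: eq_integral => z _; rewrite patchE; case: ifPn => zQ.
    by apply: eq_integral => x _; rewrite /F/= patchE zQ EFinM.
  by rewrite integral0_eq// => x _; rewrite /F/= patchE (negbTE zQ) mule0.
rewrite fubini_tonelli//; apply: eq_integral => x _; rewrite /F/=.
have mx : measurable_fun setT (fun z : d.-tuple R => (poissonRd (e n) (subRd x z))%:E).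
  by apply/measurable_EFinP; exact: (measurableT_comp (mp2 n) (pair1_measurable x)).
rewrite ge0_integralZl//; last 3 first.
- by apply/(measurable_restrictT _ _).1 => //; exact: measurable_funTS.
- by move=> z _; rewrite patchE; case: ifP => // _; rewrite lee_fin.
- by rewrite lee_fin.
rewrite EFinM; congr (_ * _)%E; rewrite -integral_mkcond.
transitivity (\int[lebRd R d]_(z in Q) (\prod_(i < d) (fun i s => (K n (tnth x i) s)%:E) i (tnth z i)))%E.
  by apply: eq_integral => z _; rewrite pE -prodEFin.
rewrite (@integral_box_prod R d a b (fun i s => (K n (tnth x i) s)%:E)).
- by rewrite /T -prodEFin; apply: eq_bigr => i _; exact: integral_poisson_itv.
- by move=> i; apply/measurable_EFinP; exact: (measurableT_comp (mK2 n) (pair1_measurable _)).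
- by move=> i s; rewrite lee_fin.
Qed.

Let T_bound n x : `|T n x| <= (2 * pi) ^+ d.
Proof.
rewrite /T normr_prod -[X in _ ^+ X](card_ord d) -prodr_const.
apply: ler_prod => i _; rewrite normr_ge0/= normrM ger0_norm// ler_wpM2l//.
rewrite ler_norml; move: ((b i - _) / _) ((a i - _) / _) => u v.
have := atan_ltpi2 u; have := atan_ltpi2 v; have := atan_gtNpi2 u; have := atan_gtNpi2 v.
by move=> *; apply/andP; split; lra.
Qed.

Let mT n : measurable_fun setT (T n).
Proof.
apply: (@measurable_tuple_prod R d (fun i s => 2 * (atan ((b i - s) / e n) - atan ((a i - s) / e n)))) => i.
have matan c : measurable_fun setT (fun s : R => atan ((c - s) / e n)).
  apply: (@measurableT_comp _ _ _ _ _ _ (@atan R)).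
    by apply: continuous_measurable_fun; exact: continuous_atan.
  by apply: measurable_funM => //; exact: measurable_funB.
by apply: measurable_funM => //; exact: measurable_funB.
Qed.

(** The exceptional points lie on the finitely many hyperplanes that carry the faces of the box. *)
Let cvg_T : {ae lebRd R d, forall x, T n x @[n --> \oo] --> (2 * pi) ^+ d * (x \in Q)%:R}.
Proof.
have : {ae lebRd R d, forall x, forall i : 'I_d, tnth x i != a i /\ tnth x i != b i}.
  apply: filter_forall => i.
  have H c : {ae lebRd R d, forall x, tnth x i != c}.
    exists [set x | tnth x i = c]; split.
    - rewrite (_ : [set x | _] = (tnth (T:=R))^~ i @^-1` [set c])//.
      by rewrite -[X in measurable X]setTI; exact: (measurable_tnth i).
    - exact: lebRd_hyperplane.
    - by move=> x /= /negP; rewrite negbK => /eqP.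
  by near=> x; split; near: x; exact: H.
apply: filterS => x xab.
have -> : (2 * pi) ^+ d * (x \in Q)%:R = \prod_(i < d) (2 * pi * (tnth x i \in `]a i, b i[)%:R) :> R.
  rewrite big_split/= prodr_const card_ord; congr (_ * _).
  have [xQ|xQ] := boolP (x \in Q).
    by rewrite big1// => i _; move: xQ; rewrite inE => /(_ i) ->.
  have [i xi] : exists i, tnth x i \notin `]a i, b i[.
    apply: contrapT => H; move/negP: xQ; apply; rewrite inE => i.
    by apply: contrapT => /negP ?; apply: H; exists i.
  by rewrite (bigD1 i)//= (negbTE xi) mul0r.
apply: cvg_prodr => i; have [? ?] := xab i; exact: cvg_poisson_itv.
Unshelve. all: by end_near. Qed.

(** Both sides are limits of the same smoothed integrals, computed once on the Fourier side and once
    through [smoothed_boxE]. *)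
Lemma invF_box_lt :
  (\int[lebRd R d]_(z in Q) (invF E z)%:E = ((2 * pi) ^+ d)%:E * \int[lebRd R d]_(x in Q) (P x)%:E)%E.
Proof.
pose M := fine (\int[lebRd R d]_xi (E xi)%:E)%E.
have c1 : (\int[lebRd R d]_(z in Q) \int[lebRd R d]_x (P x * poissonRd (e n) (subRd x z))%:E)%E @[n --> \oo]
    --> (\int[lebRd R d]_(z in Q) (invF E z)%:E)%E.
  have [] := @dominated_convergence _ _ _ (lebRd R d) Q mQ
    (fun n z => (\int[lebRd R d]_x (P x * poissonRd (e n) (subRd x z))%:E)%E)
    (fun z => (invF E z)%:E) (cst M%:E).
  - move=> n; apply: measurable_funTS.
    apply: (@measurable_integral_param _ _ _ _ _ _ (fun w : d.-tuple R * d.-tuple R => (P w.2 * poissonRd (e n) (subRd w.2 w.1))%:E)).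
    apply/measurable_EFinP; apply: measurable_funM; first exact: (measurableT_comp mP measurable_snd).
    apply: (measurableT_comp (mp2 n) (g := fun w => (w.2, w.1))).
    by apply/measurable_fun_pairP; split; [exact: measurable_snd|exact: measurable_fst].
  - by apply: measurable_funTS; apply/measurable_EFinP; exact: measurable_invF.
  - by apply: aeW => z _; exact: cvg_poisson_convolution.
  - apply/integrableP; split; first exact: measurable_cst.
    rewrite integral_cst// lte_mul_pinfty// ?abse_ge0//.
    by rewrite /= lebRd_box ?ltry// => i; exact: ltW.
  - apply: aeW => z n _; rewrite (poisson_convolution mP P0 Pi HE)//.
    apply: invF_bound => //.
      apply: measurable_funM; first exact: measurable_expRd.
      by apply: (measurableT_comp mcos); under eq_fun do rewrite dotRdC; exact: measurable_dotRd.
    move=> xi; rewrite normrM mulr_ile1 ?normr_ge0 ?cos_max//.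
    by rewrite ger0_norm ?expRd_ge0 ?expRd_le1.
  - by [].
have c2 : (\int[lebRd R d]_x (P x * T n x)%:E)%E @[n --> \oo]
    --> (\int[lebRd R d]_x (P x * ((2 * pi) ^+ d * (x \in Q)%:R))%:E)%E.
  have mPi : (lebRd R d).-integrable setT (fun x => (((2 * pi) ^+ d)%:E * (P x)%:E)%E).
    exact: integrableZl.
  have [] := @dominated_convergence _ _ _ (lebRd R d) setT measurableT
    (fun n x => (P x * T n x)%:E)
    (fun x => (P x * ((2 * pi) ^+ d * (x \in Q)%:R))%:E) (fun x => (((2 * pi) ^+ d)%:E * (P x)%:E)%E).
  - by move=> n; apply/measurable_EFinP; exact: measurable_funM.
  - apply/measurable_EFinP; apply: measurable_funM => //; apply: measurable_funM => //.
    by rewrite (_ : (fun x => _) = \1_Q)//; exact: measurable_indic.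
  - have := cvg_T; apply: filterS => x Tx _; apply: cvg_EFin; first exact: nearW.
    by rewrite /comp/=; apply: cvgM => //; exact: cvg_cst.
  - exact: mPi.
  - apply: aeW => x n _; rewrite /= -EFinM lee_fin normrM ger0_norm// mulrC.
    by rewrite ler_wpM2r// T_bound.
  - by [].
have c12 : (\int[lebRd R d]_(z in Q) (invF E z)%:E =
    \int[lebRd R d]_x (P x * ((2 * pi) ^+ d * (x \in Q)%:R))%:E)%E.
  have sE : (fun n => \int[lebRd R d]_(z in Q) \int[lebRd R d]_x (P x * poissonRd (e n) (subRd x z))%:E)%E =
      (fun n => \int[lebRd R d]_x (P x * T n x)%:E)%E.
    by apply/funext => n; rewrite smoothed_boxE.
  by rewrite sE in c1; rewrite -(cvg_lim _ c1)// -(cvg_lim _ c2).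
rewrite c12 -ge0_integralZl//.
- rewrite [RHS]integral_mkcond; apply: eq_integral => x _; rewrite patchE; case: ifP => _; rewrite -?EFinM; congr EFin; first by rewrite mulr1 mulrC.
  by rewrite !mulr0.
- by apply: measurable_funTS; exact/measurable_EFinP.
- by move=> x _; rewrite lee_fin.
- by rewrite lee_fin exprn_ge0// mulr_ge0// pi_ge0.
Qed.
End fix_box.

(** Empty boxes are included because intersections of rays with a fixed box may be empty. *)
Lemma invF_box (a b : 'I_d -> R) :
  (\int[lebRd R d]_(z in box a b) (invF E z)%:E =
   ((2 * pi) ^+ d)%:E * \int[lebRd R d]_(x in box a b) (P x)%:E)%E.
Proof.
have [ab|] := pselect (forall i, a i < b i); first exact: invF_box_lt.
move=> /existsNP[i /negP]; rewrite -leNgt => ba.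
have -> : box a b = set0; last by rewrite !integral_set0 mule0.
apply/seteqP; split => // x /(_ i); rewrite in_itv/= => /andP[ax xb].
by have := lt_trans ax xb; rewrite ltNge ba.
Qed.

End inversion_box.

(** * From boxes to almost every point *)

Section rays.
Context (R : realType) (d : nat).

(** Corners may be infinite, so the whole space is a ray; rays form a pi-system, and each meets an
    open box in a box. *)
Definition rays : set (set (d.-tuple R)) :=
  [set A | exists l : 'I_d -> \bar R, A = [set x | forall i, (l i < (tnth x i)%:E)%E]].

Lemma rays_setI_closed : setI_closed rays.
Proof.
move=> _ _ [l ->] [k ->]; exists (fun i => maxe (l i) (k i)).
apply/seteqP; split => x /=.
  by move=> [H1 H2] i; rewrite gt_max H1 H2.
by move=> H; split => i; have := H i; rewrite gt_max => /andP[].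
Qed.

Lemma measurable_tuple_rays :
  @measurable _ (d.-tuple R) = <<s rays >>.
Proof.
apply/seteqP; split.
  apply: smallest_sub; first exact: smallest_sigma_algebra.
  apply: (big_ind (fun A => A `<=` <<s rays >>)) => [|A B HA HB|i _].
  - exact: sub0set.
  - by rewrite subUset.
  move=> _ [B mB <-]; rewrite setTI.
  (* Good sets: those whose cylinder over coordinate i is generated by rays. They form a
     sigma-algebra that contains the open half-lines. *)
  pose G := [set B : set R | <<s rays >> ((tnth (T:=R))^~ i @^-1` B)].
  suff : @measurable _ R `<=` G by exact.
  have -> : @measurable _ R = <<s @RGenOInfty.G R >> by exact: RGenOInfty.measurableE.
  apply: smallest_sub; first split.
  - rewrite /G/= preimage_set0; exact: sigma_algebra0.
  - move=> A; rewrite /G/= setTD preimage_setC => H.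
    by rewrite -setTD; exact: sigma_algebraCD.
  - by move=> F HF; rewrite /G/= preimage_bigcup; exact: sigma_algebra_bigcup.
  move=> _ [c ->]; rewrite /G/=; apply: sub_sigma_algebra.
  exists (fun j => if j == i then c%:E else -oo%E).
  apply/seteqP; split => x /=.
    by move=> H j; case: eqP => [->|_]; [rewrite lte_fin; move: H; rewrite in_itv/= andbT|exact: ltNyr].
  by move=> /(_ i); rewrite eqxx lte_fin in_itv/= andbT.
apply: smallest_sub; first exact: sigma_algebra_measurable.
move=> _ [l ->].
rewrite (_ : [set x | _] = \bigcap_(i in [set: 'I_d]) ((tnth (T:=R))^~ i @^-1` [set s | (l i < s%:E)%E])).
  apply: fin_bigcap_measurable => // i _.
  rewrite -[X in measurable X]setTI; apply: measurable_tnth => //.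
  case: (l i) => [r| |].
  - rewrite (_ : [set s | _] = `]r, +oo[%classic)//.
    by apply/seteqP; split => s /=; rewrite in_itv/= andbT lte_fin.
  - by rewrite (_ : [set s | _] = set0)//; apply/seteqP; split => // s /=; rewrite ltNge leey.
  - by rewrite (_ : [set s | _] = setT)//; apply/seteqP; split => // s _ /=; exact: ltNyr.
by apply/seteqP; split => x /= H i; [move=> _; exact: H|exact: (H i I)].
Qed.

End rays.

(** The two proofs are arguments so that the measure structure can be attached to this function. *)
Definition density_measure d (T : measurableType d) (R : realType)
    (mu : {measure set T -> \bar R}) (f : T -> \bar R)
    of measurable_fun setT f & (forall x, 0 <= f x)%E :=
  fun A => (\int[mu]_(t in A) f t)%E.

Section density_measure.
Context d (T : measurableType d) (R : realType) (mu : {measure set T -> \bar R}).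
Variables (f : T -> \bar R) (mf : measurable_fun setT f) (f0 : (forall x, 0 <= f x)%E).

Local Notation nu := (density_measure mu mf f0).

Let nu0 : nu set0 = 0%E. Proof. exact: integral_set0. Qed.

Let nu_ge0 A : (0 <= nu A)%E. Proof. exact: integral_ge0. Qed.

Let nu_sigma_additive : semi_sigma_additive nu.
Proof. exact: semi_sigma_additive_nng_induced. Qed.

HB.instance Definition _ := isMeasure.Build _ _ _ nu nu0 nu_ge0 nu_sigma_additive.

End density_measure.

Section density_lower_bound.
Context (R : realType) (d : nat) (P E : d.-tuple R -> R).
Hypotheses (mP : measurable_fun setT P) (P0 : forall x, 0 <= P x).
Hypothesis (Pi : (lebRd R d).-integrable setT (EFin \o P)).
Hypotheses (E0 : forall xi, 0 <= E xi).
Hypothesis (Ei : (lebRd R d).-integrable setT (EFin \o E)).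
Hypothesis (HE : forall (xi : d.-tuple R) c,
  (\int[lebRd R d]_x (P x * cos (dotRd xi x + c))%:E = (E xi * cos c)%:E)%E).
Variables (r c : R).
Hypothesis r0 : 0 < r.
Hypothesis c0 : 0 < c.
Let U := box (fun _ : 'I_d => - r) (fun=> r).
Hypothesis Ec : forall z, U z -> c <= invF E z.

Let mU : measurable U. Proof. exact: measurable_box. Qed.

Let f1 : d.-tuple R -> \bar R := (fun x => ((2 * pi) ^+ d * P x)%:E) \_ U.
(** The cut-off to [U], where [Ec] makes [invF] positive, turns it into the density of a measure. *)
Let f2 : d.-tuple R -> \bar R := (fun x => (invF E x)%:E) \_ U.

Let mf1 : measurable_fun setT f1.
Proof.
apply: ((measurable_restrictT _ mU).1 _); apply: measurable_funTS.
by apply/measurable_EFinP; exact: measurable_funM.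
Qed.

Let f10 x : (0 <= f1 x)%E.
Proof.
rewrite /f1 patchE; case: ifP => // _; rewrite lee_fin mulr_ge0// exprn_ge0//.
by rewrite mulr_ge0// pi_ge0.
Qed.

Let mf2 : measurable_fun setT f2.
Proof.
apply: ((measurable_restrictT _ mU).1 _); apply: measurable_funTS.
by apply/measurable_EFinP; exact: measurable_invF.
Qed.

Let f20 x : (0 <= f2 x)%E.
Proof.
rewrite /f2 patchE; case: ifP => // xU; rewrite lee_fin (le_trans (ltW c0))// Ec//.
exact: set_mem.
Qed.

(** The finite measures with densities [f1] and [f2] agree on the pi-system of rays: a ray meets [U]
    in a box, where [invF_box] applies. *)
Lemma density_eq_on_box A : measurable A -> A `<=` U ->
  (((2 * pi) ^+ d)%:E * \int[lebRd R d]_(x in A) (P x)%:E = \int[lebRd R d]_(x in A) (invF E x)%:E)%E.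
Proof.
move=> mA AU.
have F (f : d.-tuple R -> R) B : measurable B ->
    (\int[lebRd R d]_(x in B) ((fun x => (f x)%:E) \_ U) x = \int[lebRd R d]_(x in B `&` U) (f x)%:E)%E.
  by move=> mB; rewrite integral_mkcondr.
have H : density_measure (lebRd R d) mf1 f10 A = density_measure (lebRd R d) mf2 f20 A.
  apply: (measure_unique (@rays R d) (fun=> setT)) => //.
  - exact: measurable_tuple_rays.
  - exact: rays_setI_closed.
  - move=> _; exists (fun=> -oo%E); apply/seteqP; split => // x _ i; exact: ltNyr.
  - by rewrite bigcup_const.
  - move=> _ [l ->].
    have mB : measurable [set x : d.-tuple R | forall i, (l i < (tnth x i)%:E)%E].
      by rewrite measurable_tuple_rays; apply: sub_sigma_algebra; exists l.
    set B := [set x | _] in mB *.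
    change (\int[lebRd R d]_(x in B) f1 x = \int[lebRd R d]_(x in B) f2 x)%E.
    rewrite /f1 /f2 !F//.
    (* Lower corner of the ray cut by [U]: a bound [+oo] becomes r, which makes the box empty as it
       should be, and [-oo] becomes -r. *)
    pose a i := if l i is s%:E then Num.max s (- r) else if l i == +oo%E then r else - r.
    have -> : B `&` U = box a (fun=> r).
      apply/seteqP; split => x /=.
        move=> [H1 H2] i; have := H1 i; have := H2 i; rewrite !in_itv/= /a.
        by case: (l i) => [s| |]/=; rewrite ?lte_fin ?gt_max// => /andP[-> ->] ->.
      move=> H; split => i; have := H i; rewrite !in_itv/= /a.
        case: (l i) => [s| |]/=.
        - by rewrite gt_max lte_fin => /andP[/andP[]].
        - by move=> /andP[/lt_trans H1 /H1]; rewrite ltxx.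
        - by rewrite ltNyr.
      case: (l i) => [s| |]/=.
      - by rewrite gt_max => /andP[/andP[_ ->]].
      - by move=> /andP[/lt_trans H1 /H1]; rewrite ltxx.
      - by [].
    rewrite (invF_box mP P0 Pi E0 Ei HE).
    rewrite -ge0_integralZl//.
    + exact: measurable_box.
    + by apply: measurable_funTS; exact/measurable_EFinP.
    + by move=> x _; rewrite lee_fin.
    + by rewrite lee_fin exprn_ge0// mulr_ge0// pi_ge0.
  - move=> _; change (\int[lebRd R d]_(x in setT) f1 x < +oo)%E; rewrite /f1 F// setTI.
    under eq_integral do rewrite EFinM.
    rewrite ge0_integralZl//.
    + rewrite lte_mul_pinfty// ?lee_fin ?exprn_ge0 ?mulr_ge0 ?pi_ge0//.
      by apply: integrable_lty => //; apply: integrableS Pi.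
    + by apply: measurable_funTS; exact/measurable_EFinP.
    + by move=> x _; rewrite lee_fin.
    + by rewrite lee_fin exprn_ge0// mulr_ge0// pi_ge0.
move: H; rewrite /density_measure /f1 /f2 !F// setIidl// => <-.
rewrite -ge0_integralZl//.
- by apply: measurable_funTS; exact/measurable_EFinP.
- by move=> x _; rewrite lee_fin.
- by rewrite lee_fin exprn_ge0// mulr_ge0// pi_ge0.
Qed.

(** On the bad set A the identity of integrals gives c |A| <= (c/2) |A|. As A is bounded, |A| is
    finite and hence zero; the halving of c provides the contradiction. *)
Lemma density_ge_ae :
  lebRd R d (U `&` [set x | P x < c / 2 / (2 * pi) ^+ d]) = 0%E.
Proof.
set c' := c / 2 / _; set A := U `&` _.
have pi0 : 0 < (2 * pi) ^+ d :> R by rewrite exprn_gt0// mulr_gt0// pi_gt0.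
have mA : measurable A.
  apply: measurableI => //.
  rewrite (_ : [set x | _] = P @^-1` `]-oo, c'[%classic).
    by rewrite -[X in measurable X]setTI; exact: mP.
  by apply/seteqP; split => x /=; rewrite in_itv.
have AU : A `<=` U by move=> x [].
have Afin : (lebRd R d A < +oo)%E.
  apply: (@le_lt_trans _ _ (lebRd R d U)); first by apply: le_measure; rewrite ?inE.
  have rr : - r <= r by rewrite (@le_trans _ _ 0)// ?oppr_le0 ltW.
  by rewrite lebRd_box ?ltry.
have H1 : (c%:E * lebRd R d A <= \int[lebRd R d]_(x in A) (invF E x)%:E)%E.
  rewrite -integral_cst//; apply: ge0_le_integral => //.
  - by move=> x _; rewrite lee_fin ltW.
  - by apply: measurable_funTS; apply/measurable_EFinP; exact: measurable_invF.
  - by move=> x Ax; rewrite lee_fin; apply: Ec; exact: AU.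
have H2 : (((2 * pi) ^+ d)%:E * \int[lebRd R d]_(x in A) (P x)%:E <= (c / 2)%:E * lebRd R d A)%E.
  have -> : c / 2 = (2 * pi) ^+ d * c' by rewrite /c' mulrCA divff ?mulr1// gt_eqF.
  rewrite EFinM -muleA lee_pmul2l//.
  rewrite -integral_cst//; apply: ge0_le_integral => //.
  - by move=> x _; rewrite lee_fin.
  - by apply: measurable_funTS; exact/measurable_EFinP.
  - by move=> x [_ /= Ax]; rewrite lee_fin ltW.
have := le_trans H1 (le_trans _ H2).
rewrite density_eq_on_box// => /(_ (lexx _)).
have Af : lebRd R d A \is a fin_num by rewrite ge0_fin_numE.
have m0 : 0 <= fine (lebRd R d A) by exact: fine_ge0.
rewrite -(fineK Af); move: (fine _) m0 => m m0; rewrite -!EFinM !lee_fin => H.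
congr EFin; apply/eqP; rewrite eq_le m0 andbT leNgt; apply/negP => m1.
by have := mulr_gt0 c0 m1; lra.
Qed.

End density_lower_bound.

(** * Stable densities near the origin *)

Section stable_char.
Context (R : realType).
Implicit Types (alpha t : R).

Lemma normRd_ge0 d (xi : d.-tuple R) : 0 <= normRd xi.
Proof. exact: sqrtr_ge0. Qed.

Lemma le_norm_normRd d (xi : d.-tuple R) i : `|tnth xi i| <= normRd xi.
Proof.
rewrite -sqrtr_sqr ler_wsqrtr// (bigD1 i)//= lerDl sumr_ge0// => j _; exact: sqr_ge0.
Qed.

Lemma measurable_normRd d : measurable_fun setT (@normRd R d).
Proof.
apply: (@measurableT_comp _ _ _ _ _ _ (@Num.sqrt R)).
  by apply: continuous_measurable_fun; exact: sqrt_continuous.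
by apply: measurable_sum => i; apply: measurable_funX; exact: measurable_tnth.
Qed.

Lemma measurable_stable_char d alpha t : measurable_fun setT (fun xi : d.-tuple R => expR (- (t * normRd xi `^ alpha))).
Proof.
apply: (@measurableT_comp _ _ _ _ _ _ (@expR R)) => //.
apply: (@measurableT_comp _ _ _ _ _ _ (@GRing.opp R)) => //.
apply: measurable_funM => //.
apply: (@measurableT_comp _ _ _ _ _ _ (fun x : R => x `^ alpha)); first exact: measurable_powR.
exact: measurable_normRd.
Qed.

Lemma powR_expR_bound alpha (k : nat) : 0 < alpha ->
  exists2 C, 0 < C & forall x, 0 <= x -> (1 + x) ^+ k <= C * expR (x `^ alpha).
Proof.
move=> a0; pose m := (Num.trunc (k%:R / alpha)).+1.
have ma : k%:R <= alpha * m%:R.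
  rewrite -ler_pdivrMl// mulrC ltW//.
  by have := truncnS_gt (k%:R / alpha).
exists (2 ^+ k * (1 + m`!%:R)); first by rewrite mulr_gt0 ?exprn_gt0// ltr_pwDl.
move=> x x0.
have e1 : 1 <= expR (x `^ alpha) by rewrite -expR0 ler_expR powR_ge0.
have [x1|x1] := leP x 1.
  rewrite -[leLHS]mulr1 -mulrA ler_pM ?exprn_ge0 ?addr_ge0//.
    by rewrite lerXn2r ?nnegrE ?addr_ge0//; lra.
  by rewrite (le_trans e1)// ler_peMl ?expR_ge0// lerDl.
have : (1 + x) ^+ k <= 2 ^+ k * x ^+ k.
  by rewrite -exprMn lerXn2r ?nnegrE ?addr_ge0 ?mulr_ge0//; lra.
move=> /le_trans; apply; rewrite -mulrA ler_wpM2l ?exprn_ge0//.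
apply: (@le_trans _ _ ((x `^ alpha) ^+ m)).
  rewrite -(powR_mulrn k x0) -(powR_mulrn m (powR_ge0 x alpha)) -powRrM.
  by rewrite ler_powR// ltW.
have := @expR_ge1Dxn R (x `^ alpha) m.-1 (powR_ge0 _ _).
rewrite prednK// => H.
have f0 : 0 < m`!%:R :> R by rewrite ltr0n fact_gt0.
have : (x `^ alpha) ^+ m / m`!%:R <= expR (x `^ alpha) by rewrite (le_trans _ H)// lerDr.
rewrite ler_pdivrMr// mulrC => /le_trans; apply.
by rewrite ler_wpM2r ?expR_ge0// lerDr.
Qed.

Lemma integral_oneDsqrV : (\int[@lebesgue_measure R]_x (oneDsqr x)^-1%:E = pi%:E)%E.
Proof.
rewrite ge0_symfun_integralT.
- rewrite (_ : [set x | 0 <= x] = `[0, +oo[%classic); last first.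
    by apply/seteqP; split => x /=; rewrite in_itv/= andbT.
  by rewrite integral0y_oneDsqr -EFinM; congr EFin; rewrite mulrCA divff ?mulr1.
- by move=> x; rewrite invr_ge0 (le_trans _ (oneDsqr_ge1 x)).
- exact: continuous_oneDsqrV.
- by move=> x /=; rewrite /oneDsqr sqrrN.
Qed.

Definition norm1Rd d (xi : d.-tuple R) : R := \sum_(i < d) `|tnth xi i|.

Lemma measurable_norm1Rd d : measurable_fun setT (@norm1Rd d).
Proof.
apply: measurable_sum => i; apply: (@measurableT_comp _ _ _ _ _ _ (@Num.norm R R)) => //.
exact: measurable_tnth.
Qed.

Lemma norm1Rd_ge0 d (xi : d.-tuple R) : 0 <= norm1Rd xi.
Proof. by apply: sumr_ge0. Qed.

Lemma norm1Rd_le d (xi : d.-tuple R) : norm1Rd xi <= d%:R * normRd xi.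
Proof.
rewrite /norm1Rd (le_trans (ler_sum _ (fun i _ => le_norm_normRd xi i)))//.
by rewrite sumr_const card_ord mulr_natl.
Qed.

(** Since (1 + |xi|)^(2d) is at least the product of the 1 + xi_i^2, the integrand is dominated by a
    product of Cauchy densities, up to a constant. *)
Lemma integral_stable_char_lty d alpha : 0 < alpha ->
  (\int[lebRd R d]_xi ((1 + norm1Rd xi) * expR (- (normRd xi `^ alpha)))%:E < +oo)%E.
Proof.
(* Of the exponent 2d + 1, the part 2d pays for the product and the last power for the first
   moment. *)
move=> a0; have [C C0 HC] := powR_expR_bound (2 * d).+1 a0.
apply: (@le_lt_trans _ _ (\int[lebRd R d]_xi (((1 + d%:R) * C)%:E * \prod_(i < d) (oneDsqr (tnth xi i))^-1%:E))%E).
  have mo : measurable_fun setT (fun x : d.-tuple R => \prod_(i < d) (oneDsqr (tnth x i))^-1%:E)%E.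
    apply: (@emeasurable_prod _ _ _ _ _ (fun i (x : d.-tuple R) => (oneDsqr (tnth x i))^-1%:E)) => i.
    apply/measurable_EFinP; apply: (@measurableT_comp _ _ _ _ _ _ (fun s : R => (oneDsqr s)^-1)).
      by apply: continuous_measurable_fun; exact: continuous_oneDsqrV.
    exact: measurable_tnth.
  apply: ge0_le_integral => //.
  - by move=> xi _; rewrite lee_fin mulr_ge0 ?expR_ge0// addr_ge0// norm1Rd_ge0.
  - apply/measurable_EFinP; apply: measurable_funM.
      by apply: measurable_funD => //; exact: measurable_norm1Rd.
    have := @measurable_stable_char d alpha 1.
    by under eq_fun do rewrite mul1r.
  - exact: emeasurable_funM.
  - move=> xi _; rewrite prodEFin -EFinM lee_fin.
    set x := normRd xi; have x0 : 0 <= x by exact: normRd_ge0.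
    have H1 : 1 + norm1Rd xi <= (1 + d%:R) * (1 + x).
      have := norm1Rd_le xi; rewrite -/x => H.
      have dr : 0 <= d%:R :> R by [].
      nra.
    have H2 : (1 + x) ^+ (2 * d) * \prod_(i < d) (oneDsqr (tnth xi i))^-1 >= 1.
      rewrite prodfV -ler_pdivrMr ?invr_gt0; last first.
        by apply: prodr_gt0 => i _; rewrite (lt_le_trans _ (oneDsqr_ge1 _)).
      rewrite invrK mul1r exprM -[X in _ <= _ ^+ X](card_ord d) -prodr_const.
      apply: ler_prod => i _; rewrite (le_trans _ (oneDsqr_ge1 _))//=.
      rewrite /oneDsqr; have := le_norm_normRd xi i; rewrite -/x => H.
      have : tnth xi i ^+ 2 <= x ^+ 2 by rewrite -real_normK ?num_real// lerXn2r ?nnegrE.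
      nra.
    have := HC x x0; rewrite exprS => H3.
    have e0 : 0 < expR (- x `^ alpha) by exact: expR_gt0.
    have pg0 : 0 <= \prod_(i < d) (oneDsqr (tnth xi i))^-1.
      by apply: prodr_ge0 => i _; rewrite invr_ge0 (le_trans _ (oneDsqr_ge1 _)).
    have H4 : (1 + x) * expR (- x `^ alpha) <= C * \prod_(i < d) (oneDsqr (tnth xi i))^-1.
      have H5 : (1 + x) * (1 + x) ^+ (2 * d) * expR (- x `^ alpha) <= C.
        apply: (@le_trans _ _ (C * expR (x `^ alpha) * expR (- x `^ alpha))); first by rewrite ler_pM2r.
        by rewrite -mulrA -expRD subrr expR0 mulr1.
      apply: (@le_trans _ _ ((1 + x) * (1 + x) ^+ (2 * d) * expR (- x `^ alpha) * \prod_(i < d) (oneDsqr (tnth xi i))^-1)); last exact: ler_wpM2r.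
      rewrite [leRHS](_ : _ = (1 + x) * expR (- x `^ alpha) * ((1 + x) ^+ (2 * d) * \prod_(i < d) (oneDsqr (tnth xi i))^-1)); last by ring.
      by rewrite ler_peMr// mulr_ge0 ?addr_ge0 ?(ltW e0).
    rewrite -mulrA (le_trans _ (ler_wpM2l _ H4)) ?addr_ge0// mulrA.
    by rewrite ler_wpM2r// ltW.
rewrite ge0_integralZl//; last 3 first.
- apply: (@emeasurable_prod _ _ _ _ _ (fun i (x : d.-tuple R) => (oneDsqr (tnth x i))^-1%:E)) => i.
  apply/measurable_EFinP; apply: (@measurableT_comp _ _ _ _ _ _ (fun s : R => (oneDsqr s)^-1)).
    by apply: continuous_measurable_fun; exact: continuous_oneDsqrV.
  exact: measurable_tnth.
- by move=> xi _; apply: prode_ge0 => i _; rewrite lee_fin invr_ge0 (le_trans _ (oneDsqr_ge1 _)).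
- by rewrite lee_fin mulr_ge0 ?addr_ge0// ltW.
rewrite (@integral_lebRd_prod R d (fun _ s => (oneDsqr s)^-1%:E)).
- rewrite (eq_bigr (fun=> pi%:E)); last by move=> i _; exact: integral_oneDsqrV.
  by rewrite prodEFin -EFinM ltry.
- by move=> i; apply/measurable_EFinP; apply: continuous_measurable_fun; exact: continuous_oneDsqrV.
- by move=> i s; rewrite lee_fin invr_ge0 (le_trans _ (oneDsqr_ge1 _)).
Qed.

(** The linear bound costs only a first moment of the characteristic function. *)
Lemma ler1_cos_norm (u : R) : 1 - `|u| <= cos u.
Proof.
wlog u0 : u / 0 <= u => [H|].
  have [/H//|u0] := leP 0 u.
  by rewrite -cosN -normrN; apply: H; rewrite oppr_ge0 ltW.
rewrite ger0_norm//; move: u0; rewrite le_eqVlt => /predU1P[<-|u0]; first by rewrite cos0 subr0.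
have [c _ H] := @MVT R (@cos R) (fun x => - sin x) 0 u u0 (fun x _ => is_derive_cos x)
  (continuous_subspaceT (@continuous_cos R)).
move: H; rewrite cos0 subr0 => H.
have : cos u = 1 - sin c * u by lra.
have s1 := sin_le1 c.
by nra.
Qed.
End stable_char.

Section stable_density.
Context (R : realType) (d : nat) (alpha : R) (p : R -> d.-tuple R -> R).
Hypotheses (d0 : (0 < d)%N) (a0 : 0 < alpha).
Hypothesis hp : is_sym_stable_density alpha p.

Let mp t : 0 < t -> measurable_fun setT (p t).
Proof.
move=> t0; have [mp _] := hp.
have mD : measurable ((`]0%R, +oo[%classic : set R) `*` [set: d.-tuple R]).
  exact: measurableX.
apply: (measurable_comp mD _ mp (pair1_measurable t)).
by move=> _ [x _ <-] /=; rewrite in_itv/= andbT.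
Qed.

Let p0 t x : 0 < t -> 0 <= p t x. Proof. by have [_ [H _]] := hp; exact: H. Qed.

Let E t (xi : d.-tuple R) := expR (- (t * normRd xi `^ alpha)).

Let mcos : measurable_fun setT (@cos R).
Proof. by apply: continuous_measurable_fun; exact: continuous_cos. Qed.

Let msin : measurable_fun setT (@sin R).
Proof. by apply: continuous_measurable_fun; exact: continuous_sin. Qed.

Lemma dot0Rd (x : d.-tuple R) : dotRd [tuple 0 | i < d] x = 0.
Proof. by rewrite /dotRd big1// => i _; rewrite tnth_mktuple mul0r. Qed.

Lemma norm0Rd : normRd [tuple (0 : R) | i < d] = 0.
Proof. by rewrite /normRd big1 ?sqrtr0// => i _; rewrite tnth_mktuple expr0n. Qed.

Lemma integral_stable_density t : 0 < t -> (\int[lebRd R d]_x (p t x)%:E = 1)%E.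
Proof.
move=> t0; have [_ [_ /(_ t [tuple 0 | i < d] t0)[H _]]] := hp.
move: H; rewrite norm0Rd powR0 ?gt_eqF// mulr0 oppr0 expR0 => <-.
rewrite -intRd_lebRd.
- by congr intRd; apply/funext => x; rewrite dot0Rd cos0 mul1r.
- by apply/measurable_EFinP; exact: mp.
- by move=> x; rewrite lee_fin p0.
Qed.

Let ip t : 0 < t -> (lebRd R d).-integrable setT (EFin \o p t).
Proof.
move=> t0; apply/integrableP; split; first by apply/measurable_EFinP; exact: mp.
rewrite (_ : (\int[_]_x _)%E = 1%E) ?ltry// -(integral_stable_density t0).
by apply: eq_integral => x _; rewrite /= ger0_norm ?p0.
Qed.

Lemma stable_density_char t (xi : d.-tuple R) c : 0 < t ->
  (\int[lebRd R d]_x (p t x * cos (dotRd xi x + c))%:E = (E t xi * cos c)%:E)%E.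
Proof.
move=> t0.
have i1 : (lebRd R d).-integrable setT (fun x => (p t x * cos (dotRd xi x))%:E).
  apply: integrable_mul_cos; [exact: ip| |by move=> x; exact: cos_max].
  by apply: (measurableT_comp mcos); exact: measurable_dotRd.
have i2 : (lebRd R d).-integrable setT (fun x => (p t x * sin (dotRd xi x))%:E).
  apply: integrable_mul_cos; [exact: ip| |by move=> x; exact: sin_max].
  by apply: (measurableT_comp msin); exact: measurable_dotRd.
have [_ [_ /(_ t xi t0)[]]] := hp.
have -> : (fun x => (cos (dotRd xi x) * p t x)%:E) = (fun x => (p t x * cos (dotRd xi x))%:E).
  by apply/funext => x; rewrite mulrC.
have -> : (fun x => (sin (dotRd xi x) * p t x)%:E) = (fun x => (p t x * sin (dotRd xi x))%:E).
  by apply/funext => x; rewrite mulrC.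
rewrite !intRd_lebRd_integrable// => Hc Hs.
transitivity (\int[lebRd R d]_x ((cos c)%:E * (p t x * cos (dotRd xi x))%:E
    - (sin c)%:E * (p t x * sin (dotRd xi x))%:E))%E.
  by apply: eq_integral => x _; rewrite -!EFinM -EFinB cosD; congr EFin; ring.
rewrite integralB//; last 2 first.
- exact: integrableZl.
- exact: integrableZl.
by rewrite !integralZl// Hc Hs mule0 sube0 -EFinM; congr EFin; rewrite mulrC.
Qed.

Let E0 t xi : 0 <= E t xi. Proof. exact: expR_ge0. Qed.

Let mE t : measurable_fun setT (E t).
Proof. exact: measurable_stable_char. Qed.

Let M0 : \bar R := (\int[lebRd R d]_xi (E 1 xi)%:E)%E.
Let M1 : \bar R := (\int[lebRd R d]_xi (norm1Rd xi * E 1 xi)%:E)%E.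

Let M01 : (M0 + M1 < +oo)%E.
Proof.
rewrite /M0 /M1 -ge0_integralD//.
- rewrite (_ : (\int[_]_x _)%E = (\int[lebRd R d]_xi ((1 + norm1Rd xi) * expR (- (normRd xi `^ alpha)))%:E)%E).
    exact: integral_stable_char_lty.
  by apply: eq_integral => xi _; rewrite -EFinD /E mul1r; congr EFin; ring.
- by move=> x _; rewrite lee_fin.
- exact/measurable_EFinP.
- by move=> x _; rewrite lee_fin mulr_ge0// norm1Rd_ge0.
- by apply/measurable_EFinP; apply: measurable_funM => //; exact: measurable_norm1Rd.
Qed.

Let M0_ge0 : (0 <= M0)%E. Proof. by apply: integral_ge0 => x _; rewrite lee_fin. Qed.
Let M1_ge0 : (0 <= M1)%E.
Proof. by apply: integral_ge0 => x _; rewrite lee_fin mulr_ge0// norm1Rd_ge0. Qed.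

Let M0_fin : M0 \is a fin_num.
Proof. by rewrite ge0_fin_numE// (le_lt_trans _ M01)// leeDl. Qed.
Let M1_fin : M1 \is a fin_num.
Proof. by rewrite ge0_fin_numE// (le_lt_trans _ M01)// leeDr. Qed.

Let M0_gt0 : 0 < fine M0.
Proof.
rewrite fine_gt0//; apply/andP; split; last by rewrite -ge0_fin_numE.
rewrite lt_neqAle M0_ge0 andbT; apply/eqP => M00.
pose Q := box (fun _ : 'I_d => (0 : R)) (fun=> 1).
have mQ : measurable Q by exact: measurable_box.
(* On the unit box the norm is at most sqrt d <= d, where d >= 1 enters, so [E 1] is at least c
   there. *)
pose c := expR (- (d%:R `^ alpha)) : R.
have c0 : 0 < c by exact: expR_gt0.
have : (c%:E * lebRd R d Q <= M0)%E.
  rewrite -integral_cst//; apply: (@le_trans _ _ (\int[lebRd R d]_(xi in Q) (E 1 xi)%:E)%E).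
    apply: ge0_le_integral => //.
    - by move=> x _; rewrite lee_fin ltW.
    - by apply: measurable_funTS; exact/measurable_EFinP.
    move=> x Qx; rewrite lee_fin ler_expR lerN2 mul1r ge0_ler_powR ?nnegrE ?normRd_ge0//; first exact: ltW.
    rewrite -[leRHS]ger0_norm// -sqrtr_sqr ler_wsqrtr//.
    apply: (@le_trans _ _ (\sum_(i < d) 1)).
      apply: ler_sum => i _; have := Qx i; rewrite in_itv/= => /andP[u v].
      by rewrite expr_le1// ltW.
    rewrite sumr_const card_ord expr2 ler_peMr//.
    by rewrite ler1n.
  apply: ge0_subset_integral => //; first exact/measurable_EFinP.
  by move=> x _; rewrite lee_fin.
rewrite -M00 lebRd_box// -EFinM lee_fin.
rewrite (eq_bigr (fun=> 1)); last by move=> i _; rewrite subr0.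
by rewrite big1_eq mulr1 leNgt c0.
Qed.

(* Substituting xi := t^(-1/alpha) xi'. *)
Let scale_E t (k : nat) (h : d.-tuple R -> R) : 0 < t ->
  measurable_fun setT h -> (forall xi, 0 <= h xi) ->
  (forall s xi, 0 < s -> h [tuple s * tnth xi i | i < d] = s ^+ k * h xi) ->
  (\int[lebRd R d]_xi (h xi * E t xi)%:E =
   ((t `^ (- alpha^-1)) ^+ (k + d))%:E * \int[lebRd R d]_xi (h xi * E 1 xi)%:E)%E.
Proof.
move=> t0 mh h0 hs.
pose s := t `^ (alpha^-1).
have s0 : 0 < s by exact: powR_gt0.
have sV : t `^ (- alpha^-1) = s^-1 by rewrite powRN.
have E1 xi : E 1 [tuple s * tnth xi i | i < d] = E t xi.
  rewrite /E mul1r; congr (expR (- _)).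
  have -> : normRd [tuple s * tnth xi i | i < d] = s * normRd xi.
    rewrite /normRd -[in RHS](ger0_norm (ltW s0)) -sqrtr_sqr -sqrtrM ?sqr_ge0//; congr Num.sqrt.
    by rewrite mulr_sumr; apply: eq_bigr => i _; rewrite tnth_mktuple exprMn.
  by rewrite powRM ?normRd_ge0// ?(ltW s0)// /s -powRrM mulVf ?gt_eqF// powRr1// ltW.
have := @ge0_integral_lebRd_affine R d s [tuple 0 | i < d] (fun xi => (h xi * E 1 xi)%:E).
rewrite gt_eqF// => /(_ isT) H.
rewrite (gtr0_norm s0) in H.
rewrite sV exprD EFinM -muleA -H; last 2 first.
- by apply/measurable_EFinP; exact: measurable_funM.
- by move=> xi; rewrite lee_fin mulr_ge0.
have aE (xi : d.-tuple R) : [tuple s * tnth xi i + tnth [tuple (0:R) | i < d] i | i < d] = [tuple s * tnth xi i | i < d].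
  by apply: eq_from_tnth => i; rewrite !tnth_mktuple addr0.
under [in RHS]eq_integral do rewrite aE hs// E1.
rewrite -ge0_integralZl//.
- by apply: eq_integral => xi _; rewrite -EFinM exprVn -!mulrA mulKf// gt_eqF// exprn_gt0.
- by apply/measurable_EFinP; apply: measurable_funM => //; exact: measurable_funM.
- by move=> xi _; rewrite lee_fin mulr_ge0// mulr_ge0// exprn_ge0// ltW.
- by rewrite lee_fin exprn_ge0// invr_ge0 ltW.
Qed.

Let Et t : 0 < t -> (\int[lebRd R d]_xi (E t xi)%:E = ((t `^ (- alpha^-1)) ^+ d)%:E * M0)%E.
Proof.
move=> t0; have := @scale_E t 0 (fun=> 1) t0.
under eq_integral do rewrite mul1r.
by under [in RHS]eq_integral do rewrite mul1r; apply => // *; rewrite expr0 mul1r.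
Qed.

Let E1t t : 0 < t -> (\int[lebRd R d]_xi (norm1Rd xi * E t xi)%:E = ((t `^ (- alpha^-1)) ^+ d.+1)%:E * M1)%E.
Proof.
move=> t0; apply: (@scale_E t 1 (@norm1Rd R d) t0).
- exact: measurable_norm1Rd.
- exact: norm1Rd_ge0.
move=> s xi s0; rewrite /norm1Rd expr1 mulr_sumr; apply: eq_bigr => i _.
by rewrite tnth_mktuple normrM gtr0_norm.
Qed.

Let iE t : 0 < t -> (lebRd R d).-integrable setT (EFin \o E t).
Proof.
move=> t0; apply/integrableP; split; first exact/measurable_EFinP.
rewrite (_ : (\int[_]_x _)%E = (\int[lebRd R d]_xi (E t xi)%:E)%E); last first.
  by apply: eq_integral => xi _; rewrite /= ger0_norm.
by rewrite Et// -(fineK M0_fin) -EFinM ltry.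
Qed.

(** For |z_i| < r, the bound cos u >= 1 - |u| leaves at least the integral of E minus r times that
    of [norm1Rd] E. With r = delta t^(1/alpha), both terms scale like t^(-d/alpha). *)
Lemma stable_density_lower_bound : exists delta c : R, [/\ 0 < delta, 0 < c &
  forall t, 0 < t -> lebRd R d (box (fun _ => - (delta * t `^ alpha^-1)) (fun=> delta * t `^ alpha^-1) `&`
     [set x | p t x < c * (t `^ (- alpha^-1)) ^+ d]) = 0%E].
Proof.
(* Makes delta M1 <= M0/2, so the cosine correction consumes at most half of the main term. *)
pose delta := fine M0 / (2 * (1 + fine M1)).
have m1 : 0 <= fine M1 by exact: fine_ge0.
have delta0 : 0 < delta by rewrite divr_gt0 ?mulr_gt0 ?ltr_pwDl.
(* One factor 1/2 is the cosine correction, the other comes from [density_ge_ae], and (2 pi)^d from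
   inversion. *)
exists delta, (fine M0 / 2 / 2 / (2 * pi) ^+ d); split => //.
  by rewrite divr_gt0 ?divr_gt0// exprn_gt0// mulr_gt0// pi_gt0.
move=> t t0; set r := delta * _.
have ta0 : 0 < t `^ alpha^-1 by exact: powR_gt0.
have r0 : 0 < r by exact: mulr_gt0.
set u := t `^ (- alpha^-1).
have u0 : 0 < u by exact: powR_gt0.
have ru : r * u = delta by rewrite /r /u powRN mulfK// gt_eqF.
pose c := fine M0 / 2 * u ^+ d.
have c0 : 0 < c by rewrite mulr_gt0 ?divr_gt0 ?exprn_gt0.
have -> : fine M0 / 2 / 2 / (2 * pi) ^+ d * u ^+ d = c / 2 / (2 * pi) ^+ d.
  by rewrite /c; ring.
apply: (@density_ge_ae R d (p t) (E t) _ _ _ _ _ _ r c r0 c0) => //.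
- exact: mp.
- by move=> x; exact: p0.
- exact: ip.
- exact: iE.
- by move=> xi s; exact: stable_density_char.
move=> z Uz; rewrite -lee_fin invFE; [|exact: iE].
have mdz : measurable_fun setT (fun xi : d.-tuple R => dotRd xi z).
  by under eq_fun do rewrite dotRdC; exact: measurable_dotRd.
have inE' : (lebRd R d).-integrable setT (fun xi => (norm1Rd xi * E t xi)%:E).
  apply/integrableP; split.
    by apply/measurable_EFinP; apply: measurable_funM => //; exact: measurable_norm1Rd.
  rewrite (_ : (\int[_]_x _)%E = (\int[lebRd R d]_xi (norm1Rd xi * E t xi)%:E)%E); last first.
    by apply: eq_integral => xi _; rewrite /= ger0_norm// mulr_ge0// norm1Rd_ge0.
  by rewrite E1t// -(fineK M1_fin) -EFinM ltry.
apply: (@le_trans _ _ (\int[lebRd R d]_xi ((E t xi)%:E - r%:E * (norm1Rd xi * E t xi)%:E))%E).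
  rewrite integralB//; [|exact: iE|exact: integrableZl].
  rewrite integralZl// Et// E1t// -(fineK M0_fin) -(fineK M1_fin) -!EFinM -EFinB lee_fin.
  rewrite -/u exprS !mulrA ru /c.
  have h : delta * fine M1 <= fine M0 / 2.
    rewrite /delta invfM mulrA -mulrA ler_piMr ?divr_ge0 ?(ltW M0_gt0)//.
    by rewrite mulrC ler_pdivrMr ?ltr_pwDl// mul1r lerDr.
  have : 0 < u ^+ d by rewrite exprn_gt0.
  move: (u ^+ d) => v v0; nra.
apply: le_integral => //.
- by apply: integrableB => //; [exact: iE|exact: integrableZl].
- apply: integrable_mul_cos; [exact: iE| |by move=> x; exact: cos_max].
  exact: (measurableT_comp mcos).
move=> xi _; rewrite -EFinM -EFinB lee_fin.
have H1 := ler1_cos_norm (dotRd xi z).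
have H2 : `|dotRd xi z| <= r * norm1Rd xi.
  rewrite /dotRd /norm1Rd mulr_sumr (le_trans (ler_norm_sum _ _ _))//.
  apply: ler_sum => i _; rewrite normrM mulrC ler_wpM2r//.
  by rewrite ler_norml; have := Uz i; rewrite in_itv/= => /andP[/ltW -> /ltW ->].
have := E0 t xi; nra.
Qed.

End stable_density.

(** * Lower bound for the time-fractional kernel *)

Section cubes.
Context (R : realType) (d : nat).
Implicit Types (x y : d.-tuple R) (r : R).

Definition cube x r : set (d.-tuple R) :=
  box (fun i => tnth x i - r) (fun i => tnth x i + r).

Lemma measurable_cube x r : measurable (cube x r).
Proof. exact: measurable_box. Qed.

Lemma subRd_box x y r : box (fun=> - r) (fun=> r) (subRd x y) <-> cube x r y.
Proof.
split=> H i; have := H i; rewrite !in_itv/= tnth_mktuple => /andP[H1 H2]; apply/andP; split; lra.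
Qed.

Lemma subset_cube x r r' : r <= r' -> cube x r `<=` cube x r'.
Proof.
move=> rr y H i; have := H i; rewrite !in_itv/= => /andP[H1 H2]; apply/andP; split; lra.
Qed.

Lemma measurable_subRd x : measurable_fun setT (fun y => subRd x y).
Proof.
apply/measurable_fun_tnthP => i.
rewrite (_ : _ \o _ = fun y => tnth x i - tnth y i); last first.
  by apply/funext => y /=; rewrite tnth_mktuple.
by apply: measurable_funB => //; exact: measurable_tnth.
Qed.

(** Carries an almost-everywhere bound on P to the convolution variable y in P(x - y). *)
Lemma lebRd_subRd_null x (N : set (d.-tuple R)) : measurable N ->
  lebRd R d N = 0%E -> lebRd R d [set y | N (subRd x y)] = 0%E.
Proof.
move=> mN N0.
have mN' : measurable [set y | N (subRd x y)].
  rewrite (_ : [set y | _] = subRd x @^-1` N)//.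
  by rewrite -[X in measurable X]setTI; exact: measurable_subRd.
rewrite -[LHS]mul1e -(integral_cst _ mN') integral_mkcond.
transitivity (\int[lebRd R d]_y (\1_N (subRd x y))%:E)%E.
  apply: eq_integral => y _; rewrite patchE indicE.
  have [Ny|Ny] := pselect (N (subRd x y)); first by rewrite !mem_set.
  by rewrite !memNset.
rewrite (@ge0_integral_lebRd_subRd R d x (fun y => (\1_N y)%:E)).
- by rewrite integral_indic// setIT.
- by apply/measurable_EFinP; exact: measurable_indic.
- by move=> y; rewrite lee_fin.
Qed.

End cubes.

Section stable_convolution.
Context (R : realType) (d : nat) (P : d.-tuple R -> R) (r c : R).
Hypotheses (mP : measurable_fun setT P) (P0 : forall x, 0 <= P x) (c0 : 0 <= c).
Hypothesis Pc : lebRd R d (box (fun=> - r) (fun=> r) `&` [set x | P x < c]) = 0%E.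

(** The bound P >= c on the cube may fail on a null set, which the integral does not see. *)
Lemma convolution_cube (x : d.-tuple R) (f : d.-tuple R -> \bar R) :
  measurable_fun setT f -> (forall y, 0 <= f y)%E ->
  (c%:E * \int[lebRd R d]_(y in cube x r) f y <=
   \int[lebRd R d]_y ((P (subRd x y))%:E * f y))%E.
Proof.
move=> mf f0.
rewrite -ge0_integralZl//; last 2 first.
- exact: measurable_cube.
- exact: measurable_funTS.
rewrite integral_mkcond.
have mPx : measurable_fun setT (fun y => P (subRd x y)).
  by apply: (measurableT_comp mP); exact: measurable_subRd.
apply: ae_ge0_le_integral => //.
- by move=> y _; rewrite patchE; case: ifP => // _; rewrite mule_ge0.
- apply: ((measurable_restrictT _ (measurable_cube x r)).1 _); apply: measurable_funTS.
  exact: emeasurable_funM.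
- by move=> y _; rewrite mule_ge0// lee_fin.
- by apply: emeasurable_funM => //; exact/measurable_EFinP.
pose N := box (fun=> - r) (fun=> r) `&` [set x : d.-tuple R | P x < c].
have mN : measurable N.
  apply: measurableI; first exact: measurable_box.
  rewrite (_ : [set x | _] = P @^-1` `]-oo, c[%classic).
    by rewrite -[X in measurable X]setTI; exact: mP.
  by apply/seteqP; split => y /=; rewrite in_itv.
exists [set y | N (subRd x y)]; split.
- rewrite (_ : [set y | _] = subRd x @^-1` N)//.
  by rewrite -[X in measurable X]setTI; exact: measurable_subRd.
- exact: lebRd_subRd_null.
move=> y /= /not_implyP[_]; rewrite patchE; case: ifPn => [|_].
  move=> /set_mem yx H; split; first exact/subRd_box.
  rewrite /= ltNge; apply/negP => cP; apply: H.
  by rewrite lee_wpmul2r.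
by move=> []; rewrite mule_ge0// lee_fin.
Qed.

End stable_convolution.

(** * Mass of the subordinator near 0 *)

Section subordinator.
Context (R : realType) (beta : R) (g : R -> R).
Hypotheses (b0 : 0 < beta) (b1 : beta < 1).
Hypothesis hg : is_stable_subordinator_density beta g.

Let mg : measurable_fun (`]0%R, +oo[%classic : set R) g. Proof. by case: hg. Qed.
Let g0 u : 0 < u -> 0 <= g u. Proof. by case: hg => _ [H _]; exact: H. Qed.

(** Without mass on ]0, b] the Laplace transform would be at most exp(-s b), while it equals
    exp(-s^beta), which is larger for large s because beta < 1. *)
Lemma subordinator_mass_near0 b : 0 < b -> (0 < \int[@lebesgue_measure R]_(u in `]0%R, b]) (g u)%:E)%E.
Proof.
move=> b_gt0; rewrite lt_neqAle integral_ge0 ?andbT; last first.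
  by move=> u /=; rewrite in_itv/= => /andP[u0 _]; rewrite lee_fin g0.
apply/eqP => /esym gb.
have [_ [_ hL]] := hg.
have sub1 : `]0, b]%classic `<=` (`]0%R, +oo[%classic : set R).
  by move=> u /=; rewrite !in_itv/= andbT => /andP[].
have sub2 : `]b, +oo[%classic `<=` (`]0%R, +oo[%classic : set R).
  by move=> u /=; rewrite !in_itv/= !andbT; exact: lt_trans.
have mge s : measurable_fun (`]0%R, +oo[%classic : set R) (fun u => (expR (- (s * u)) * g u)%:E).
  apply/measurable_EFinP; apply: measurable_funM => //; apply: measurable_funTS.
  apply: (@measurableT_comp _ _ _ _ _ _ (@expR R)) => //.
  by apply: (@measurableT_comp _ _ _ _ _ _ (@GRing.opp R)) => //; exact: measurable_funM.
have meg : measurable_fun (`]0%R, +oo[%classic : set R) (EFin \o g) by exact/measurable_EFinP.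
have H s : 0 < s -> expR (- s `^ beta) <= expR (- (s * b)).
  move=> s0; rewrite -lee_fin -hL; last exact: ltW.
  have U0 : `]0, b]%classic `|` `]b, +oo[%classic = (`]0%R, +oo[%classic : set R).
    apply/seteqP; split => u /=; rewrite !in_itv/= !andbT.
      by move=> [/andP[]//|]; exact: lt_trans.
    by move=> u0; have [ub|ub] := leP u b; [left; rewrite u0|right].
  rewrite -U0.
  rewrite ge0_integral_setU//=; last 3 first.
  - by rewrite U0; exact: mge.
  - move=> u; rewrite -[X in X -> _]/((`]0, b]%classic `|` `]b, +oo[%classic) u) U0/= in_itv/= andbT => u0.
    by rewrite lee_fin mulr_ge0 ?expR_ge0 ?g0.
  - apply/disj_setPS => u [] /=; rewrite !in_itv/= andbT => /andP[_ ub] /(le_lt_trans ub).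
    by rewrite ltxx.
  have -> : (\int[@lebesgue_measure R]_(u in `]0%R, b]) (expR (- (s * u)) * g u)%:E = 0)%E.
    apply/eqP; rewrite eq_le; apply/andP; split; last first.
      by apply: integral_ge0 => u /sub1/=; rewrite in_itv/= andbT => u0; rewrite lee_fin mulr_ge0 ?expR_ge0 ?g0.
    rewrite -gb; apply: ge0_le_integral => //.
    - by move=> u /sub1/=; rewrite in_itv/= andbT => u0; rewrite lee_fin mulr_ge0 ?expR_ge0 ?g0.
    - exact: measurable_funS (mge s).
    - exact: measurable_funS meg.
    move=> u /sub1/=; rewrite in_itv/= andbT => u0; rewrite lee_fin ler_piMl ?g0//.
    by rewrite -expR0 ler_expR oppr_le0 mulr_ge0// ltW.
  rewrite add0e.
  apply: (@le_trans _ _ (\int[@lebesgue_measure R]_(u in `]b, +oo[) ((expR (- (s * b)))%:E * (g u)%:E))%E).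
    apply: ge0_le_integral => //.
    - by move=> u /sub2/=; rewrite in_itv/= andbT => u0; rewrite lee_fin mulr_ge0 ?expR_ge0 ?g0.
    - exact: measurable_funS (mge s).
    - by apply: emeasurable_funM => //; exact: measurable_funS meg.
    move=> u /[dup] /sub2/=; rewrite !in_itv/= !andbT => u0 bu; rewrite -EFinM lee_fin ler_wpM2r ?g0//.
    by rewrite ler_expR lerN2 ler_wpM2l// ltW.
  rewrite ge0_integralZl//; last 2 first.
  - exact: measurable_funS meg.
  - by move=> u /sub2/=; rewrite in_itv/= andbT => u0; rewrite lee_fin g0.
  rewrite -[leRHS]mule1 lee_wpmul2l ?lee_fin ?expR_ge0//.
  apply: (@le_trans _ _ (\int[@lebesgue_measure R]_(u in `]0%R, +oo[) (g u)%:E)%E).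
    apply: ge0_subset_integral => //.
    by move=> u /=; rewrite in_itv/= andbT => u0; rewrite lee_fin g0.
  have := hL 0 (lexx _); rewrite powR0 ?gt_eqF// oppr0 expR0 => <-.
  apply: ge0_le_integral => //.
  - by move=> u /=; rewrite in_itv/= andbT => u0; rewrite lee_fin g0.
  - exact: mge.
  - by move=> u _; rewrite mul0r oppr0 expR0 mul1r.
(* Chosen with s^(1-beta) = 1 + 1/b, so that s b = s^beta (b + 1) exceeds s^beta. *)
pose s := (1 + b^-1) `^ (1 - beta)^-1.
have bb : 0 < 1 - beta by rewrite subr_gt0.
have s0 : 0 < s by rewrite powR_gt0// addr_gt0// invr_gt0.
have := H s s0; rewrite ler_expR lerN2.
have sE : s = s `^ beta * s `^ (1 - beta).
  rewrite -powRD; last by rewrite (gt_eqF s0) implybT.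
  have -> : beta + (1 - beta) = 1 by ring.
  by rewrite powRr1// ltW.
have sb : s `^ (1 - beta) = 1 + b^-1.
  by rewrite -powRrM mulVf ?gt_eqF// powRr1// addr_ge0// invr_ge0 ltW.
have -> : s * b = s `^ beta * (1 + b^-1) * b by rewrite -sb -sE.
rewrite -mulrA mulrDl mul1r mulVf ?gt_eqF//.
have : 0 < s `^ beta by exact: powR_gt0.
move: (s `^ beta) => w w0; nra.
Qed.

(** The intervals [1/(n+1), b] increase to ]0, b], so one of them carries mass. A left end a > 0 is
    wanted because a^kappa enters the kernel bound. *)
Lemma subordinator_mass_itv b : 0 < b -> exists2 a, 0 < a &
  (0 < \int[@lebesgue_measure R]_(u in `[a, b]) (g u)%:E)%E.
Proof.
move=> b_gt0; apply: contrapT => H.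
have := subordinator_mass_near0 b_gt0.
have F0 n : (\int[@lebesgue_measure R]_(u in `[(n.+1%:R^-1)%R, b]) (g u)%:E = 0)%E.
  apply/eqP; rewrite eq_le; apply/andP; split.
    by rewrite leNgt; apply/negP => K; apply: H; exists n.+1%:R^-1.
  apply: integral_ge0 => u /=; rewrite in_itv/= => /andP[u0 _]; rewrite lee_fin g0//.
  by rewrite (lt_le_trans _ u0).
have UE : \bigcup_n `[n.+1%:R^-1, b]%classic = `]0, b]%classic :> set R.
  apply/seteqP; split => u /=.
    by move=> [n _] /=; rewrite !in_itv/= => /andP[nu ->]; rewrite (lt_le_trans _ nu).
  rewrite in_itv/= => /andP[u0 ub]; exists (Num.trunc u^-1) => //=; rewrite in_itv/= ub andbT.
  by rewrite -[leRHS]invrK lef_pV2 ?posrE ?invr_gt0// ltW// truncnS_gt.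
pose F (n : nat) : set (measurableTypeR R) := `[n.+1%:R^-1 : R, b]%classic.
have ndF : {homo F : n m / (n <= m)%N >-> (n <= m)%O}.
  move=> m n mn; apply/subsetPset => u; rewrite /F/= !in_itv/= => /andP[mu ->]; rewrite andbT.
  by rewrite (le_trans _ mu)// lef_pV2 ?posrE// ler_nat ltnS.
have mF n : measurable (F n) by exact: measurable_itv.
have mgF n : measurable_fun (F n) (EFin \o g).
  apply/measurable_EFinP; apply: measurable_funS mg => //.
  by move=> u; rewrite /F/= !in_itv/= andbT => /andP[nu _]; rewrite (lt_le_trans _ nu).
have gF0 n u : F n u -> (0 <= (EFin \o g) u)%E.
  by rewrite /F/= in_itv/= => /andP[nu _]; rewrite lee_fin g0// (lt_le_trans _ nu).
have := @ge0_nondecreasing_set_cvg_integral _ _ R F (EFin \o g) (@lebesgue_measure R) ndF mF mgF gF0.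
rewrite /F UE /=.
under eq_fun do rewrite F0.
by move=> /cvg_lim <-//; rewrite lim_cst// ltxx.
Qed.

End subordinator.

Section kernel_bound.
Context (R : realType) (d : nat) (alpha beta : R) (p : R -> d.-tuple R -> R) (g : R -> R).
Hypotheses (d0 : (0 < d)%N) (a0 : 0 < alpha) (b0 : 0 < beta) (b1 : beta < 1).
Hypotheses (hp : is_sym_stable_density alpha p) (hg : is_stable_subordinator_density beta g).

Let D0 : set R := `]0%R, +oo[%classic.
Let mD0 : measurable D0. Proof. exact: measurable_itv. Qed.
(** p and g are constrained only at positive times and arguments; extension by zero yields the
    global measurability that Tonelli uses. *)
Let pe : R * d.-tuple R -> R := (fun z => p z.1 z.2) \_ (D0 `*` setT).
Let ge : R -> R := g \_ D0.

Let mpe : measurable_fun setT pe.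
Proof.
have mD : measurable (D0 `*` [set: d.-tuple R]) by apply: measurableX; [exact: mD0|exact: measurableT].
apply: ((measurable_restrictT _ mD).1 _); exact: hp.1.
Qed.

Let mge : measurable_fun setT ge.
Proof. by apply: ((measurable_restrictT _ mD0).1 _); exact: hg.1. Qed.

Let peE s x : 0 < s -> pe (s, x) = p s x.
Proof. by move=> s0; rewrite /pe patchE mem_set//; split => //=; rewrite /D0/= in_itv/= s0. Qed.

Let geE u : 0 < u -> ge u = g u.
Proof. by move=> u0; rewrite /ge patchE mem_set// /D0/= in_itv/= u0. Qed.

Let pe_ge0 z : 0 <= pe z.
Proof.
rewrite /pe patchE; case: ifPn => // /set_mem[/=]; rewrite /D0/= in_itv/= andbT => z0 _.
by have [_ [H _]] := hp; exact: H.
Qed.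

Let ge_ge0 u : 0 <= ge u.
Proof.
rewrite /ge patchE; case: ifPn => // /set_mem/=; rewrite /D0/= in_itv/= andbT => u0.
by have [_ [H _]] := hg; exact: H.
Qed.

(** Equal to (t/u)^beta for positive t and u; the inverse is a real power so that [measurable_powR]
    applies to it. *)
Let tau (t u : R) : R := (t * u `^ (-1)) `^ beta.

Let tauE t u : 0 < t -> 0 < u -> tau t u = (t / u) `^ beta.
Proof. by move=> t0 u0; rewrite /tau powR_inv1// ltW. Qed.

Let integrand (w : (R * d.-tuple R) * R) : \bar R := (pe (tau w.1.1 w.2, w.1.2) * ge w.2)%:E.

Let mintegrand : measurable_fun setT integrand.
Proof.
apply/measurable_EFinP; apply: measurable_funM; last exact: (measurableT_comp mge measurable_snd).
apply: (measurableT_comp mpe); apply/measurable_fun_pairP; split; last first.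
  exact: (measurableT_comp measurable_snd measurable_fst).
apply: (@measurableT_comp _ _ _ _ _ _ (fun x : R => x `^ beta)); first exact: measurable_powR.
apply: measurable_funM; first exact: (measurableT_comp measurable_fst measurable_fst).
apply: (@measurableT_comp _ _ _ _ _ _ (fun x : R => x `^ (-1))); first exact: measurable_powR.
exact: measurable_snd.
Qed.

Let integrand_ge0 w : (0 <= integrand w)%E.
Proof. by rewrite lee_fin mulr_ge0. Qed.

(* An everywhere measurable version of the kernel, agreeing with it for t > 0. *)
Definition GkernelT (z : R * d.-tuple R) : \bar R := (\int[@lebesgue_measure R]_u integrand (z, u))%E.

Lemma measurable_GkernelT : measurable_fun setT GkernelT.
Proof. exact: (measurable_integral_param (@lebesgue_measure R) mintegrand). Qed.

Lemma GkernelT_ge0 z : (0 <= GkernelT z)%E.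
Proof. exact: integral_ge0. Qed.

Lemma GkernelTE t x : 0 < t -> Gkernel beta p g t x = GkernelT (t, x).
Proof.
move=> t0; rewrite /Gkernel /GkernelT integral_mkcond; apply: eq_integral => u _.
rewrite patchE /integrand/=; case: ifPn => [/set_mem/=|/negP].
  rewrite in_itv/= andbT => u0; rewrite tauE// peE ?geE//.
  by rewrite powR_gt0// divr_gt0.
move=> H; rewrite /ge patchE memNset ?mulr0// => H'; apply: H; exact: mem_set.
Qed.

(** For u in [a, b] put s = (t/u)^beta. Then s^(-d/alpha) = t^(-kappa) u^kappa >= a^kappa
    t^(-kappa), and the cube on which p(s,.) is bounded below has radius delta (t/u)^(beta/alpha) >=
    L t^(beta/alpha). *)
Lemma Gkernel_convolution_lower (L : R) : 0 < L -> exists2 c : R, 0 < c &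
  forall t x (f : d.-tuple R -> \bar R), 0 < t -> measurable_fun setT f -> (forall y, 0 <= f y)%E ->
  ((c * t `^ (- (beta * d%:R / alpha)))%:E * \int[lebRd R d]_(y in cube x (L * t `^ (beta / alpha))) f y
   <= \int[lebRd R d]_y (GkernelT (t, subRd x y) * f y))%E.
Proof.
move=> L0.
have [delta [c0 [delta0 c00 hlow]]] := stable_density_lower_bound d0 a0 hp.
(* Solves delta b^(-beta/alpha) = L. *)
pose b := (delta / L) `^ (alpha / beta).
have b_gt0 : 0 < b by rewrite powR_gt0// divr_gt0.
have [a a_gt0 mass] := subordinator_mass_itv b0 b1 hg b_gt0.
pose m := (\int[@lebesgue_measure R]_(u in `[a, b]) (ge u)%:E)%E.
have ab0 u : u \in `[a, b] -> 0 < u by rewrite in_itv/= => /andP[/(lt_le_trans a_gt0)].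
have mE : m = (\int[@lebesgue_measure R]_(u in `[a, b]) (g u)%:E)%E.
  by apply: eq_integral => u /set_mem/= /ab0 u0; rewrite geE.
(* The Laplace identity at s = 0 bounds the mass by 1. *)
have m_fin : m \is a fin_num.
  rewrite ge0_fin_numE; last by apply: integral_ge0 => u _; rewrite lee_fin.
  apply: (@le_lt_trans _ _ (\int[@lebesgue_measure R]_(u in D0) (g u)%:E)%E).
    rewrite mE; apply: ge0_subset_integral => //.
    - by apply/measurable_EFinP; exact: hg.1.
    - by move=> u; rewrite /D0/= in_itv/= andbT => u0; rewrite lee_fin; have [_ [H _]] := hg; exact: H.
    - by move=> u /= /ab0 u0; rewrite /D0/= in_itv/= u0.
  have [_ [_ /(_ 0 (lexx _))]] := hg.
  rewrite (_ : (\int[_]_(u in _) _)%E = (\int[@lebesgue_measure R]_(u in D0) (g u)%:E)%E); last first.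
    by apply: eq_integral => u _; rewrite mul0r oppr0 expR0 mul1r.
  by move=> ->; rewrite ltry.
have m_gt0 : 0 < fine m by rewrite fine_gt0// mE mass -mE -ge0_fin_numE// integral_ge0// => u _; rewrite lee_fin.
pose kappa := beta * d%:R / alpha.
exists (fine m * (c0 * a `^ kappa)); first by rewrite !mulr_gt0// powR_gt0.
move=> t x f t0 mf f0.
set I := (\int[lebRd R d]_(y in cube x _) f y)%E.
have I0 : (0 <= I)%E by exact: integral_ge0.
pose W (w : d.-tuple R * R) : \bar R := (integrand ((t, subRd x w.1), w.2) * f w.1)%E.
have mW : measurable_fun setT W.
  apply: emeasurable_funM; last exact: (measurableT_comp mf measurable_fst).
  apply: (measurableT_comp mintegrand); apply/measurable_fun_pairP; split; last exact: measurable_snd.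
  apply/measurable_fun_pairP; split; first exact: measurable_cst.
  exact: (measurableT_comp (measurable_subRd x) measurable_fst).
have W0 w : (0 <= W w)%E by rewrite mule_ge0.
have -> : (\int[lebRd R d]_y (GkernelT (t, subRd x y) * f y) =
    \int[lebRd R d]_y \int[@lebesgue_measure R]_u W (y, u))%E.
  apply: eq_integral => y _; rewrite /W/= ge0_integralZr//.
  exact: (measurableT_comp mintegrand (pair1_measurable _)).
rewrite fubini_tonelli//.
apply: (@le_trans _ _ (\int[@lebesgue_measure R]_(u in `[a, b]) ((ge u)%:E * (((c0 * a `^ kappa) * t `^ (- kappa))%:E * I)))%E).
  have -> : (\int[@lebesgue_measure R]_(u in `[a, b]) ((ge u)%:E * (((c0 * a `^ kappa) * t `^ (- kappa))%:E * I)))%E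
      = (m * (((c0 * a `^ kappa) * t `^ (- kappa))%:E * I))%E.
    apply: ge0_integralZr => //.
    - by apply: measurable_funTS; exact/measurable_EFinP.
    - by move=> u _; rewrite lee_fin.
    - by rewrite mule_ge0// lee_fin !mulr_ge0 ?powR_ge0// ltW.
  by rewrite -{2}(fineK m_fin) muleA -EFinM !mulrA.
apply: (@le_trans _ _ (\int[@lebesgue_measure R]_(u in `[a, b]) \int[lebRd R d]_y W (y, u))%E); last first.
  apply: ge0_subset_integral => //.
  - exact: measurable_fun_fubini_tonelli_G.
  - by move=> u _; exact: integral_ge0.
apply: ge0_le_integral => //.
- by move=> u _; rewrite mule_ge0 ?lee_fin// mule_ge0// lee_fin !mulr_ge0 ?powR_ge0// ltW.
- by apply: emeasurable_funM => //; apply: measurable_funTS; exact/measurable_EFinP.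
- by apply: measurable_funTS; exact: measurable_fun_fubini_tonelli_G.
move=> u uab; have u0 := ab0 u uab.
have [au ub] : a <= u /\ u <= b by move: uab; rewrite /= in_itv/= => /andP.
pose s := (t / u) `^ beta.
have tu0 : 0 < t / u by exact: divr_gt0.
have s0 : 0 < s by exact: powR_gt0.
have mps : measurable_fun setT (p s).
  rewrite (_ : p s = pe \o pair s); first exact: (measurableT_comp mpe (pair1_measurable s)).
  by apply/funext => y /=; rewrite peE.
have -> : (\int[lebRd R d]_y W (y, u) = (ge u)%:E * \int[lebRd R d]_y ((p s (subRd x y))%:E * f y))%E.
  rewrite -ge0_integralZl//.
  - by apply: eq_integral => y _; rewrite /W /integrand/= tauE// peE// mulrC EFinM muleA.
  - apply: emeasurable_funM => //; apply/measurable_EFinP.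
    exact: (measurableT_comp mps (measurable_subRd x)).
  - by move=> y _; rewrite mule_ge0// lee_fin -peE.
  - by rewrite lee_fin.
apply: lee_wpmul2l; first by rewrite lee_fin.
have hs : 0 <= c0 * (s `^ (- alpha^-1)) ^+ d by rewrite mulr_ge0 ?exprn_ge0 ?powR_ge0// ltW.
have := @convolution_cube R d (p s) (delta * s `^ alpha^-1) (c0 * (s `^ (- alpha^-1)) ^+ d) mps _ hs (hlow s s0) x f mf f0.
move=> H; apply: (le_trans _ (H _)); last by move=> y; rewrite -peE.
have constant_le : c0 * a `^ kappa * t `^ (- kappa) <= c0 * (s `^ (- alpha^-1)) ^+ d.
  rewrite -mulrA ler_wpM2l ?(ltW c00)//.
  rewrite /s -powRrM -powR_mulrn ?powR_ge0// -powRrM.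
  have -> : beta * - alpha^-1 * d%:R = - kappa by rewrite /kappa; ring.
  rewrite !powRN ler_pdivrMr ?powR_gt0// [(t / u) `^ _]powRM ?invr_ge0 ?(ltW t0) ?(ltW u0)//.
  rewrite invfM mulrC mulrA divff ?gt_eqF ?powR_gt0// mul1r.
  rewrite -[u^-1]powR_inv1 ?(ltW u0)// -powRrM mulN1r powRN invrK.
  by rewrite ge0_ler_powR// ?nnegrE ?(ltW a_gt0) ?(ltW u0)// divr_ge0 ?mulr_ge0// ltW.
have radius_le : L * t `^ (beta / alpha) <= delta * s `^ alpha^-1.
  have -> : s `^ alpha^-1 = (t / u) `^ (beta / alpha) by rewrite /s -powRrM.
  rewrite powRM ?invr_ge0 ?(ltW t0) ?(ltW u0)// mulrCA mulrC ler_wpM2l ?powR_ge0//.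
  have th0 : 0 < beta / alpha by exact: divr_gt0.
  have -> : L = delta * b^-1 `^ (beta / alpha).
    rewrite /b -[(_ `^ _)^-1]powR_inv1 ?powR_ge0// -!powRrM.
    have -> : alpha / beta * (-1 * (beta / alpha)) = -1 by field; rewrite !gt_eqF.
    by rewrite powR_inv1 ?divr_ge0 ?ltW// invf_div mulrCA divff ?mulr1// gt_eqF.
  rewrite ler_wpM2l ?(ltW delta0)// ge0_ler_powR ?nnegrE ?invr_ge0 ?(ltW th0) ?(ltW u0) ?(ltW b_gt0)//.
  by rewrite lef_pV2 ?posrE.
have constant_ge0 : 0 <= c0 * a `^ kappa * t `^ (- kappa) by rewrite !mulr_ge0 ?powR_ge0// ltW.
have integral_le : (I <= \int[lebRd R d]_(y in cube x (delta * s `^ alpha^-1)) f y)%E.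
  apply: ge0_subset_integral.
  - exact: measurable_cube.
  - exact: measurable_cube.
  - exact: measurable_funTS.
  - by move=> y _; exact: f0.
  - exact: subset_cube.
by apply: lee_pmul; [rewrite lee_fin|exact: I0|rewrite lee_fin|exact: integral_le].
Qed.

End kernel_bound.

(** * Blow-up *)

Lemma bernoulli_le (R : realFieldType) (a : R) (k : nat) : 1 <= a -> 1 + k%:R * (a - 1) <= a ^+ k.
Proof.
move=> a1; elim: k => [|k IH]; first by rewrite mul0r addr0 expr0.
rewrite exprS -natr1; have k0 : 0 <= k%:R :> R by exact: ler0n.
have b0 : 0 <= a - 1 by rewrite subr_ge0.
have : a * (1 + k%:R * (a - 1)) <= a * a ^+ k by rewrite ler_wpM2l// (le_trans _ a1).
have : 0 <= k%:R * (a - 1) * (a - 1) by rewrite !mulr_ge0.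
lra.
Qed.

Section blow_up.
Context (R : realType) (d : nat) (theta eta : R) (G : R * d.-tuple R -> \bar R).
Hypotheses (th0 : 0 < theta) (eta0 : 0 < eta) (crit : theta * d%:R * eta <= 1).
Let kappa := theta * d%:R.
Hypothesis Glow : forall L : R, 0 < L -> exists2 c : R, 0 < c &
  forall t x (f : d.-tuple R -> \bar R), 0 < t -> measurable_fun setT f -> (forall y, 0 <= f y)%E ->
  ((c * t `^ (- kappa))%:E * \int[lebRd R d]_(y in cube x (L * t `^ theta)) f y
   <= \int[lebRd R d]_y (G (t, subRd x y) * f y))%E.

Variables (V0 : d.-tuple R -> R) (V : R -> d.-tuple R -> \bar R).
Hypotheses (mV0 : measurable_fun setT V0) (V00 : forall y, 0 <= V0 y).
Hypothesis V0_gt0 : (0 < \int[lebRd R d]_y (V0 y)%:E)%E.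
Hypotheses (mV : forall s, 0 < s -> measurable_fun setT (V s)).
Hypotheses (V_ge0 : forall s y, 0 < s -> (0 <= V s y)%E).
Hypothesis V_linear : forall t x, 0 < t ->
  (\int[lebRd R d]_y (G (t, subRd x y) * (V0 y)%:E) <= V t x)%E.
(** Contribution of one time window: a real minorant [phi] of the spatial integrals is integrated in
    time. Later uses insert a multiple of 1/s or a constant. *)
Hypothesis V_source : forall t x a b (phi : R -> R), 0 < a -> a <= b -> b <= t ->
  measurable_fun (`]a, b[%classic : set R) phi -> (forall s, s \in `]a, b[ -> 0 <= phi s) ->
  (forall s, s \in `]a, b[ ->
     ((phi s)%:E <= \int[lebRd R d]_y (G ((t - s)%R, subRd x y) * poweR (V s y) (1 + eta)%R))%E) ->
  (\int[@lebesgue_measure R]_(s in `]a, b[) (phi s)%:E <= V t x)%E.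

Lemma powR_neg_le (a b k : R) : 0 < a -> a <= b -> 0 <= k -> b `^ (- k) <= a `^ (- k).
Proof.
move=> a0 ab k0; rewrite !powRN lef_pV2 ?posrE ?powR_gt0 ?(lt_le_trans a0)//.
by rewrite ge0_ler_powR ?nnegrE ?(ltW a0) ?(ltW (lt_le_trans a0 ab)).
Qed.

Let o : d.-tuple R := [tuple 0 | i < d].

Let kappa_ge0 : 0 <= kappa. Proof. by rewrite mulr_ge0// ltW. Qed.

Lemma cube0P r (y : d.-tuple R) : cube o r y <-> forall i, `|tnth y i| < r.
Proof.
by split=> H i; have := H i; rewrite !in_itv/= tnth_mktuple sub0r add0r -ltr_norml.
Qed.

Lemma cubeP x r (y : d.-tuple R) : cube x r y <-> forall i, `|tnth x i - tnth y i| < r.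
Proof.
split=> H i; have := H i; rewrite !in_itv/= ltr_norml => /andP[H1 H2]; apply/andP; split; lra.
Qed.

(** The box where V >= B must lie in the cube around x but may be off-centre, which the iteration
    exploits. *)
Lemma source_lower (L c : R) :
  (forall t x (f : d.-tuple R -> \bar R), 0 < t -> measurable_fun setT f -> (forall y, 0 <= f y)%E ->
  ((c * t `^ (- kappa))%:E * \int[lebRd R d]_(y in cube x (L * t `^ theta)) f y
   <= \int[lebRd R d]_y (G (t, subRd x y) * f y))%E) -> 0 < c ->
  forall (t s : R) x (u v : 'I_d -> R) (l B : R), 0 < s -> s < t -> 0 <= l -> 0 <= B ->
  (forall i, v i - u i = l) -> box u v `<=` cube x (L * (t - s) `^ theta) ->
  (forall y, box u v y -> (B%:E <= V s y)%E) ->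
  ((c * (t - s) `^ (- kappa) * (l ^+ d * B `^ (1 + eta)))%:E <=
   \int[lebRd R d]_y (G ((t - s)%R, subRd x y) * poweR (V s y) (1 + eta)%R))%E.
Proof.
move=> low c0 t s x u v l B s0 st l0 B0 uv sub BV.
have mf : measurable_fun setT (fun y => poweR (V s y) (1 + eta)%R).
  by apply: (measurableT_comp (@measurable_poweR R (1 + eta))); exact: mV.
have ts : 0 < t - s by rewrite subr_gt0.
have := low (t - s) x (fun y => poweR (V s y) (1 + eta)%R) ts mf (fun y => poweR_ge0 _ _).
apply: le_trans.
rewrite EFinM lee_wpmul2l ?lee_fin ?mulr_ge0 ?powR_ge0 ?(ltW c0)//.
apply: (@le_trans _ _ (\int[lebRd R d]_(y in box u v) poweR (V s y) (1 + eta)%R)%E); last first.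
  apply: ge0_subset_integral => //; [exact: measurable_box|exact: measurable_cube| | ].
    exact: measurable_funTS.
  by move=> y _; exact: poweR_ge0.
apply: (@le_trans _ _ (\int[lebRd R d]_(y in box u v) (cst (B `^ (1 + eta)%R)%:E y))%E).
  rewrite integral_cst; last exact: measurable_box.
  have boxE : lebRd R d (box u v) = (l ^+ d)%:E.
    rewrite lebRd_box; last by move=> i; rewrite -subr_ge0 uv.
    rewrite (eq_bigr (fun=> l)); last by move=> i _; exact: uv.
    by rewrite prodr_const card_ord.
  rewrite (_ : _ * _ = (B `^ (1 + eta)%R)%:E * (l ^+ d)%:E)%E; last by congr (_ * _)%E; exact: boxE.
  by rewrite -EFinM mulrC.
apply: ge0_le_integral => //.
- exact: measurable_box.
- by move=> y _; rewrite lee_fin powR_ge0.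
- exact: measurable_funTS.
move=> y yb; rewrite /= -poweR_EFin; apply: gt0_ler_poweR.
- by rewrite addr_ge0// ltW.
- by rewrite in_itv/= lee_fin B0 leey.
- by rewrite in_itv/= leey andbT V_ge0.
- exact: BV.
Qed.

Let lower_bound_from (A tA : R) := forall t x, tA <= t -> cube o (t `^ theta) x ->
  ((A * t `^ (- kappa))%:E <= V t x)%E.

(** The factor 2 covers |x_i| + |y_i|, and 2^theta the passage from t^theta to (t - s)^theta when s
    <= t/2. *)
Let L1 : R := 2 * 2 `^ theta.
Let L1_ge2 : 2 <= L1.
Proof. by rewrite /L1 ler_peMr// -[leLHS](powRr0 2) ler_powR ?ler1n// ltW. Qed.

Let L1_gt0 : 0 < L1. Proof. exact: lt_le_trans L1_ge2. Qed.

Let powR_kappa (t : R) : 0 <= t -> (t `^ theta) ^+ d = t `^ kappa.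
Proof. by move=> t0; rewrite -powR_mulrn ?powR_ge0// -powRrM. Qed.

(** Some cube carries positive mass of V0. For large t it lies in the cube of radius [L1] t^theta
    around every x considered, where the kernel is bounded below. *)
Lemma initial_lower_bound : exists2 A, 0 < A & exists2 tA, 1 <= tA & lower_bound_from A tA.
Proof.
have [c c0 low] := Glow L1_gt0.
have [N N0] : exists N : nat, (0 < \int[lebRd R d]_(y in cube o N%:R) (V0 y)%:E)%E.
  apply: contrapT => H.
  have F0 n : (\int[lebRd R d]_(y in cube o n%:R) (V0 y)%:E = 0)%E.
    apply/eqP; rewrite eq_le; apply/andP; split.
      by rewrite leNgt; apply/negP => K; apply: H; exists n.
    by apply: integral_ge0 => y _; rewrite lee_fin.
  have UE : \bigcup_n cube o n%:R = setT.
    apply/seteqP; split => // y _; exists (Num.trunc (norm1Rd y)).+1 => //; apply/cube0P => i.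
    apply: (@le_lt_trans _ _ (norm1Rd y)); last exact: truncnS_gt.
    by rewrite /norm1Rd (bigD1 i)//= lerDl sumr_ge0.
  have := @ge0_nondecreasing_set_cvg_integral _ _ R (fun n => cube o n%:R) (fun y => (V0 y)%:E) (lebRd R d).
  rewrite UE => cv.
  have : (\int[lebRd R d]_(y in cube o n%:R) (V0 y)%:E)%E @[n --> \oo] --> (\int[lebRd R d]_y (V0 y)%:E)%E.
    apply: cv.
    - by move=> m n mn; apply/subsetPset; apply: subset_cube; rewrite ler_nat.
    - by move=> n; exact: measurable_cube.
    - by move=> n; apply: measurable_funTS; exact/measurable_EFinP.
    - by move=> n y _; rewrite lee_fin.
  under eq_fun do rewrite F0.
  move=> /cvg_lim cl; move: V0_gt0; rewrite -cl// lim_cst// ltxx//.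
(* The mass of V0 on the cube may be infinite, so only a real minorant is extracted. *)
have [m m0 mI] : exists2 m : R, 0 < m & (m%:E <= \int[lebRd R d]_(y in cube o N%:R) (V0 y)%:E)%E.
  move: N0; case: (\int[_]_(y in _) _)%E => [r| |]//.
    by rewrite lte_fin => r0; exists r.
  by exists 1; rewrite ?leey.
exists (c * m); first exact: mulr_gt0.
(* The second entry ensures N <= t^theta; the entry 1 is what later gives s^(-kappa eta) >= 1/s. *)
pose tA := Num.max 1 (N%:R `^ theta^-1) : R.
have tA1 : 1 <= tA by rewrite /tA le_max lexx.
exists tA => // t x tAt xt.
have t0 : 0 < t by rewrite (lt_le_trans _ tAt)// (lt_le_trans _ tA1).
have Nt : N%:R <= t `^ theta.
  have thn : theta != 0 by rewrite gt_eqF.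
  rewrite [leLHS](_ : _ = (N%:R `^ theta^-1) `^ theta); last by rewrite -powRrM mulVf// powRr1.
  rewrite ge0_ler_powR ?nnegrE ?powR_ge0 ?(ltW t0) ?(ltW th0)//.
  by rewrite (le_trans _ tAt)// /tA le_max lexx orbT.
apply: le_trans (V_linear x t0).
have mV0' : measurable_fun setT (EFin \o V0) by exact/measurable_EFinP.
apply: le_trans (low t x (EFin \o V0) t0 mV0' _); last by move=> y; rewrite lee_fin.
rewrite mulrAC EFinM lee_wpmul2l ?lee_fin ?mulr_ge0 ?powR_ge0 ?(ltW c0)//.
apply: (le_trans mI); apply: ge0_subset_integral => //.
- exact: measurable_cube.
- exact: measurable_cube.
- exact: measurable_funTS.
- by move=> y _; rewrite lee_fin.
move=> y /cube0P yN; apply/cubeP => i.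
have := yN i; have := (cube0P _ _).1 xt i => H1 H2.
have tt0 : 0 < t `^ theta by exact: powR_gt0.
apply: (le_lt_trans (ler_normB _ _)); have := L1_ge2; nra.
Qed.

Lemma integral_inv_itv (a b : R) : 0 < a -> a < b ->
  (\int[@lebesgue_measure R]_(s in `]a, b[) (s^-1)%:E = (ln b - ln a)%:E)%E.
Proof.
move=> a_gt0 ab.
have cV : {within `[a, b], continuous (fun s : R => s^-1)}.
  apply: continuous_in_subspaceT => s; rewrite inE/= in_itv/= => /andP[as_ _].
  by apply: inv_continuous; rewrite gt_eqF// (lt_le_trans a_gt0).
have cln s : 0 < s -> {for s, continuous (@ln R)} by move=> ?; exact: continuous_ln.
rewrite -(@integral_itv_bndoo _ _ _ _ true false); last first.
  apply/measurable_EFinP; apply: subspace_continuous_measurable_fun => //.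
  apply: continuous_subspaceW cV => s /=; rewrite !in_itv/= => /andP[/ltW -> /ltW ->]//.
rewrite (@continuous_FTC2 _ (fun s => s^-1) (@ln R) a b)// ?EFinB//.
- split.
  + move=> z; rewrite in_itv/= => /andP[az _].
    by have [] := is_derive1_ln (lt_trans a_gt0 az).
  + exact/cvg_at_right_filter/cln.
  + by apply/cvg_at_left_filter/cln; exact: lt_trans ab.
- move=> z; rewrite in_itv/= => /andP[az _]; rewrite derive1E.
  by have [_ ->] := is_derive1_ln (lt_trans a_gt0 az).
Qed.

(** The cube of radius s^theta has volume at least s^kappa, so V >= A s^(-kappa) makes the source at
    time s at least C t^(-kappa) s^(-kappa eta) >= C t^(-kappa) / s. The resulting logarithm is
    unbounded, so a single application reaches any [A']. *)
Lemma lower_bound_improve (A tA : R) : 0 < A -> 1 <= tA -> lower_bound_from A tA ->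
  forall A', exists2 tA', 1 <= tA' & lower_bound_from A' tA'.
Proof.
move=> A0 tA1 hA A'.
have [c c0 low] := Glow L1_gt0.
have tA0 : 0 < tA by exact: lt_le_trans tA1.
pose C := c * A `^ (1 + eta).
have C0 : 0 < C by rewrite mulr_gt0 ?powR_gt0.
(* The required value of the logarithm: C K >= A', and t >= 2 tA exp(K) gives ln(t/2) - ln(tA) >= K.
   The entry 1 keeps the window nonempty. *)
pose K := Num.max 1 (A' / C).
have K1 : 1 <= K by rewrite /K le_max lexx.
have eK : 1 <= expR K by rewrite -expR0 ler_expR (le_trans _ K1).
exists (2 * tA * expR K).
  by rewrite (le_trans tA1)// mulrAC ler_peMl ?(ltW tA0)// (le_trans eK)// ler_peMl ?expR_ge0// ler1n.
move=> t x tt xt.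
have t2 : tA * expR K <= t / 2 by rewrite ler_pdivlMr// mulrC mulrA.
have tAt2 : tA < t / 2.
  by rewrite (lt_le_trans _ t2)// ltr_pMr// -expR0 ltr_expR (lt_le_trans _ K1).
have t0 : 0 < t by rewrite -(@pmulr_lgt0 _ 2^-1)// (lt_trans tA0).
have tk0 : 0 <= t `^ (- kappa) by exact: powR_ge0.
(* Stopping at t/2 keeps t - s above t/2, so the cube of radius s^theta at the origin lies within
   reach of x. *)
apply: (@le_trans _ _ (\int[@lebesgue_measure R]_(s in `]tA, (t / 2)%R[) (C * t `^ (- kappa) * s^-1)%:E)%E).
  under eq_integral do rewrite EFinM.
  have mi : measurable_fun (`]tA, (t / 2)[%classic : set R) (fun s : R => (s^-1)%:E).
    apply/measurable_EFinP; apply: subspace_continuous_measurable_fun => //.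
    apply: continuous_in_subspaceT => s; rewrite inE/= in_itv/= => /andP[as_ _].
    by apply: inv_continuous; rewrite gt_eqF// (lt_trans tA0).
  rewrite ge0_integralZl//; last 2 first.
  - by move=> s /=; rewrite in_itv/= => /andP[as_ _]; rewrite lee_fin invr_ge0 ltW// (lt_trans tA0).
  - by rewrite lee_fin mulr_ge0// ltW.
  rewrite integral_inv_itv// -EFinM lee_fin mulrAC ler_wpM2r//.
  have : K <= ln (t / 2) - ln tA.
    rewrite lerBrDl -(expRK K) -lnM ?posrE ?expR_gt0//.
    by rewrite ler_ln ?posrE ?mulr_gt0 ?expR_gt0// (lt_trans tA0).
  move=> KL; apply: (@le_trans _ _ (C * K)); last by rewrite ler_wpM2l// ltW.
  by rewrite mulrC -ler_pdivrMr// /K le_max lexx orbT.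
apply: V_source => //.
- exact: ltW.
- lra.
- apply: measurable_funM => //; apply: subspace_continuous_measurable_fun => //.
  apply: continuous_in_subspaceT => s; rewrite inE/= in_itv/= => /andP[as_ _].
  by apply: inv_continuous; rewrite gt_eqF// (lt_trans tA0).
- move=> s; rewrite in_itv/= => /andP[as_ _]; rewrite mulr_ge0//; first by rewrite mulr_ge0// ltW.
  by rewrite invr_ge0 ltW// (lt_trans tA0).
move=> s; rewrite in_itv/= => /andP[as_ sb].
have s0 : 0 < s by exact: lt_trans as_.
have s1 : 1 <= s by rewrite (le_trans tA1)// ltW.
have ts : s < t by lra.
have st0 : 0 < s `^ theta by exact: powR_gt0.
have H := @source_lower L1 c low c0 t s x (fun=> - (s `^ theta)) (fun=> s `^ theta)
  (2 * s `^ theta) (A * s `^ (- kappa)) s0 ts.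
apply: (le_trans _ (H _ _ _ _ _)); clear H.
- rewrite lee_fin /C -!mulrA ler_wpM2l ?(ltW c0)//.
  rewrite mulrCA; apply: ler_pM; rewrite ?mulr_ge0 ?powR_ge0 ?invr_ge0 ?(ltW s0)//.
    by apply: powR_neg_le => //; lra.
  rewrite powRM ?powR_ge0 ?(ltW A0)// mulrCA ler_wpM2l ?powR_ge0//.
  apply: (@le_trans _ _ (s `^ kappa * (s `^ (- kappa)) `^ (1 + eta))).
    rewrite -powRrM -powRD; last by rewrite (gt_eqF s0) implybT.
    rewrite -[s^-1]powR_inv1 ?(ltW s0)// ler_powR//.
    have -> : kappa + - kappa * (1 + eta) = - (kappa * eta) by ring.
    by rewrite lerN2.
  rewrite ler_wpM2r ?powR_ge0// -powR_kappa ?(ltW s0)//.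
  by rewrite lerXn2r ?nnegrE ?mulr_ge0 ?(ltW st0)//; lra.
- by rewrite mulr_ge0// ltW.
- by rewrite mulr_ge0 ?powR_ge0// ltW.
- by move=> i; ring.
- move=> y yb; apply/cubeP => i.
  have H1 : `|tnth y i| < s `^ theta by have := yb i; rewrite in_itv/= ltr_norml.
  have H2 := (cube0P _ _).1 xt i.
  apply: (le_lt_trans (ler_normB _ _)).
  have H3 : t `^ theta <= 2 `^ theta * (t - s) `^ theta.
    rewrite -powRM//; last by rewrite subr_ge0 ltW.
    by rewrite ge0_ler_powR ?nnegrE ?mulr_ge0 ?subr_ge0 ?(ltW th0) ?(ltW t0) ?(ltW ts)//; lra.
  have H4 : s `^ theta <= t `^ theta by rewrite ge0_ler_powR ?nnegrE ?(ltW th0) ?(ltW s0) ?(ltW t0) ?(ltW ts).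
  rewrite /L1 -mulrA; lra.
- move=> y yb; apply: hA; first exact: ltW.
  by apply/cube0P => i; have := yb i; rewrite in_itv/= ltr_norml.
Qed.

(** By induction V >= lam^k B0 from time T (2 - 2^(-k)) up to 3T. Step k multiplies the bound by T
    c2 B0^eta / 2 times lam^(k eta) 2^(-k), that is by T c2 B0^eta / 2, which is at least lam. *)
Lemma blow_up_cubes : exists2 T0, 1 <= T0 & forall T t x, T0 <= T ->
  2 * T <= t -> t <= 3 * T -> cube o (T `^ theta) x -> V t x = +oo%E.
Proof.
have [c c0 low] := Glow L1_gt0.
(* The boxes used below have volume 2^(-kappa) (t-s)^kappa, which cancels the decay (t-s)^(-kappa)
   of the kernel and leaves this constant. *)
pose c2 := c * 2 `^ (- kappa).
have c20 : 0 < c2 by rewrite mulr_gt0 ?powR_gt0.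
pose lam := 2 `^ eta^-1 : R.
have lam0 : 0 < lam by exact: powR_gt0.
have lam_eta : lam `^ eta = 2 by rewrite /lam -powRrM mulVf ?gt_eqF// powRr1.
have lam1 : 1 < lam.
  rewrite ltNge; apply/negP => lam1.
  have : lam `^ eta <= 1 `^ eta by rewrite ge0_ler_powR ?nnegrE ?(ltW eta0) ?(ltW lam0).
  by rewrite lam_eta powR1; lra.
clearbody lam.
(* The threshold: 6 = 2 * 3, with 2 from the window length T 2^(-k) / 2 and 3 from times up to 3T.
   It depends on neither T nor k, so one T0 serves all T. *)
pose A := (6 * lam / c2) `^ eta^-1.
have A0 : 0 < A by rewrite powR_gt0// divr_gt0// mulr_gt0.
have A_eta : A `^ eta = 6 * lam / c2.
  by rewrite /A -powRrM mulVf ?gt_eqF// powRr1// divr_ge0 ?mulr_ge0 ?ltW.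
clearbody A.
have [A1 A10 [tA1 tA11 hA1]] := initial_lower_bound.
have [T0 T01 hA] := lower_bound_improve A10 tA11 hA1 A.
exists T0 => // T t x T0T tT1 tT2 xT.
have T1 : 1 <= T by exact: le_trans T0T.
have T_gt0 : 0 < T by exact: lt_le_trans T1.
pose B0 := A * (3 * T) `^ (- kappa).
have B00 : 0 < B0 by rewrite mulr_gt0 ?powR_gt0 ?mulr_gt0.
have B0_eta : 2 * lam <= T * c2 * B0 `^ eta.
  rewrite /B0 powRM ?powR_ge0 ?(ltW A0)// A_eta -powRrM.
  have H : (3 * T)^-1 <= (3 * T) `^ (- kappa * eta).
    rewrite -[leLHS]powR_inv1 ?mulr_ge0 ?(ltW T_gt0)// ler_powR//; first lra.
    by rewrite mulNr lerN2.
  apply: (@le_trans _ _ (T * c2 * (6 * lam / c2 * (3 * T)^-1))).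
    by rewrite le_eqVlt; apply/orP; left; apply/eqP; field; rewrite !gt_eqF.
  have W1 : 0 <= T * c2 by rewrite mulr_ge0// ltW.
  have W2 : 0 <= 6 * lam / c2 by rewrite divr_ge0 ?mulr_ge0// ltW.
  exact/(ler_wpM2l W1)/(ler_wpM2l W2).
pose R0 := T `^ theta.
have R00 : 0 < R0 by exact: powR_gt0.
have claim (k : nat) : forall t x, T * (2 - 2^-1 ^+ k) <= t -> t <= 3 * T -> cube o R0 x ->
    ((lam ^+ k * B0)%:E <= V t x)%E.
  elim: k => [|k IH] {tT1 tT2 xT} t {}x tk t3 xT.
    have Tt : T <= t by move: tk; rewrite expr0; lra.
    have t0 : 0 < t by exact: lt_le_trans Tt.
    rewrite expr0 mul1r; apply: (@le_trans _ _ (A * t `^ (- kappa))%:E).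
      by rewrite lee_fin ler_wpM2l ?(ltW A0)// powR_neg_le.
    apply: hA; first exact: le_trans Tt.
    apply: subset_cube xT.
    by rewrite ge0_ler_powR ?nnegrE ?(ltW th0) ?(ltW T_gt0) ?(ltW t0).
  pose q := 2^-1 ^+ k : R.
  have q0 : 0 < q by rewrite exprn_gt0// invr_gt0.
  have q1 : q <= 1 by rewrite /q exprn_ile1// invf_le1// ler1n.
  have tk' : T * (2 - q / 2) <= t by move: tk; rewrite exprSr.
  (* Source times run between the k-th and the (k+1)-st starting time, a window of length T
     2^(-k-1). *)
  pose a := T * (2 - q); pose b := T * (2 - q / 2).
  have Ta : T <= a by rewrite /a; nra.
  have ab : a < b by rewrite /a /b; nra.
  have a0 : 0 < a by exact: lt_le_trans Ta.
  pose B := lam ^+ k * B0.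
  have B_gt0 : 0 < B by rewrite mulr_gt0// exprn_gt0.
  apply: (@le_trans _ _ (\int[@lebesgue_measure R]_(s in `]a, b[) (cst (c2 * B `^ (1 + eta)) s)%:E)%E).
    rewrite (_ : (\int[_]_(s in _) _)%E = (\int[@lebesgue_measure R]_(s in `]a, b[) cst (c2 * B `^ (1 + eta))%:E s)%E)//.
    rewrite integral_cst//= lebesgue_measure_itv/= lte_fin ab -EFinD -EFinM lee_fin.
    rewrite powRD; last by rewrite (gt_eqF B_gt0) implybT.
    rewrite powRr1 ?(ltW B_gt0)//.
    have -> : B `^ eta = 2 ^+ k * B0 `^ eta.
      rewrite /B powRM ?exprn_ge0 ?(ltW lam0) ?(ltW B00)//.
      by rewrite -powR_mulrn ?(ltW lam0)// -powRrM [k%:R * eta]mulrC powRrM lam_eta powR_mulrn.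
    have -> : b - a = T * q / 2 by rewrite /a /b -mulrBr -mulrA; congr (_ * _); lra.
    have -> : c2 * (B * (2 ^+ k * B0 `^ eta)) * (T * q / 2) = B * (T * c2 * B0 `^ eta) / 2 * (2 ^+ k * q) by ring.
    have -> : 2 ^+ k * q = 1 by rewrite /q -exprMn divff// expr1n.
    rewrite mulr1 exprS -mulrA -/B.
    by rewrite -mulrA [leRHS](_ : _ = T * c2 * B0 `^ eta / 2 * B) ?ler_wpM2r ?(ltW B_gt0)//; [lra|ring].
  apply: V_source => //.
  - exact: ltW.
  - by move=> s _; rewrite mulr_ge0 ?powR_ge0// ltW.
  move=> s; rewrite in_itv/= => /andP[as_ sb].
  have s0 : 0 < s by exact: lt_trans as_.
  have st : s < t by exact: lt_le_trans tk'.
  have ts0 : 0 < t - s by rewrite subr_gt0.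
  (* As t - s <= 2T, this side is at most R0; its power of t - s gives the box the volume that
     balances the kernel. *)
  pose l := 2 `^ (- theta) * (t - s) `^ theta.
  have l0 : 0 < l by rewrite mulr_gt0 ?powR_gt0.
  have lR : l <= R0.
    have H : (t - s) `^ theta <= 2 `^ theta * R0.
      rewrite /R0 -powRM ?(ltW T_gt0)// ge0_ler_powR ?nnegrE ?(ltW th0) ?(ltW ts0) ?mulr_ge0 ?(ltW T_gt0)//.
      lra.
    by rewrite /l powRN mulrC ler_pdivrMr ?powR_gt0// mulrC.
  have lts : l <= (t - s) `^ theta.
    rewrite /l ler_piMl ?powR_ge0// -[leRHS](powRr0 2) ler_powR ?ler1n//.
    by rewrite oppr_le0 ltW.
  (* In each coordinate the box extends from x towards the origin, so it stays in the cube of radius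
     R0, where [IH] holds, even for x near the boundary. *)
  pose u (i : 'I_d) := if 0 <= tnth x i then tnth x i - l else tnth x i.
  have H := @source_lower L1 c low c0 t s x u (fun i => u i + l) l B s0 st (ltW l0) (ltW B_gt0).
  have xi i : `|tnth x i| < R0 by exact: (cube0P _ _).1 xT i.
  apply: (le_trans _ (H _ _ _)); clear H.
  - rewrite lee_fin mulrA le_eqVlt; apply/orP; left; apply/eqP; congr (_ * _).
    rewrite /c2 -mulrA; congr (c * _).
    rewrite /l exprMn powR_kappa ?(ltW ts0)// -powR_mulrn ?powR_ge0// -powRrM mulNr -/kappa.
    rewrite mulrCA -powRD; last by rewrite (gt_eqF ts0) implybT.
    by rewrite addNr powRr0 mulr1.
  - by move=> i; ring.
  - move=> y yb; apply/cubeP => i; apply: (@lt_le_trans _ _ (L1 / 2 * l *+ 2)).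
      have := yb i; rewrite in_itv/= /u ltr_norml.
      have := L1_ge2; case: ifPn => _ L2 /andP[y1 y2]; apply/andP; split; nra.
    by have := L1_ge2 => L2; rewrite -mulr_natr; nra.
  - move=> y yb; apply: IH.
    + by rewrite -/q -/a ltW.
    + by rewrite (le_trans _ t3)// ltW.
    apply/cube0P => i; have := yb i; have := xi i; rewrite in_itv/= /u !ltr_norml.
    case: ifPn => [x0|]; last rewrite -ltNge => x0.
      by move=> /andP[x1 x2] /andP[y1 y2]; apply/andP; split; lra.
    by move=> /andP[x1 x2] /andP[y1 y2]; apply/andP; split; lra.
have V0t : (0 <= V t x)%E by apply: V_ge0; lra.
have HV k : ((lam ^+ k * B0)%:E <= V t x)%E.
  apply: claim => //; apply: le_trans tT1; rewrite mulrC ler_wpM2r ?(ltW T_gt0)//.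
  by rewrite gerBl exprn_ge0// invr_ge0.
apply/eqP; rewrite eq_le leey/=; apply/negPn/negP => Vlt.
have {}Vlt : (V t x < +oo)%E by rewrite ltNge.
move: V0t Vlt HV; case: (V t x) => [v| |]// v0 _ HV.
(* By Bernoulli lam^k >= k (lam - 1), so for this k the lower bound exceeds the supposed finite
   value v. *)
pose k := (Num.trunc (v / (B0 * (lam - 1)))).+1.
have lam10 : 0 < lam - 1 by rewrite subr_gt0.
have Hk : v / (B0 * (lam - 1)) < k%:R by exact: truncnS_gt.
have := HV k; apply/negP; rewrite -ltNge lte_fin.
have H1 : v < k%:R * (B0 * (lam - 1)) by rewrite -ltr_pdivrMr// mulr_gt0.
rewrite (lt_le_trans H1)// mulrCA [leRHS]mulrC ler_wpM2l ?(ltW B00)//.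
by apply: le_trans (bernoulli_le k (ltW lam1)); rewrite lerDr.
Qed.

Lemma blow_up : exists t0, 0 < t0 /\ forall t x, t0 < t -> V t x = +oo%E.
Proof.
have [T0 T01 hT] := blow_up_cubes.
have T00 : 0 < T0 by exact: lt_le_trans T01.
exists (2 * T0); split=> [|t x tT]; first exact: mulr_gt0.
have t_gt0 : 0 < t by apply: lt_trans tT; exact: mulr_gt0.
(* b is the midpoint of 2 T0 and t, so t - s >= h throughout the window, whose length is also h. *)
pose b := T0 + t / 2; pose h := (t - 2 * T0) / 2.
have h0 : 0 < h by rewrite divr_gt0// subr_gt0.
(* Makes L h^theta = [norm1Rd x + 1], so the cube around x contains the unit cube at the origin. *)
pose L := (norm1Rd x + 1) / h `^ theta.
have n0 : 0 <= norm1Rd x by rewrite /norm1Rd sumr_ge0.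
have hth : 0 < h `^ theta by exact: powR_gt0.
have L0 : 0 < L by rewrite divr_gt0// ltr_wpDl.
have [c c_gt0 low] := Glow L0.
(* V is infinite on the unit cube at the source times, but [source_lower] takes finite heights; all
   B >= 1 are used, for which B^(1+eta) >= B. *)
have HB B : 1 <= B -> ((h * (c * t `^ (- kappa) * (2 ^+ d * B)))%:E <= V t x)%E.
  move=> B1; have B_gt0 : 0 < B by exact: lt_le_trans B1.
  pose M := c * t `^ (- kappa) * (2 ^+ d * B).
  have M0 : 0 <= M by rewrite !mulr_ge0 ?powR_ge0 ?exprn_ge0// ltW.
  apply: (@le_trans _ _ (\int[@lebesgue_measure R]_(s in `](2 * T0)%R, b[) (cst M s)%:E)%E).
    rewrite (_ : (\int[_]_(s in _) _)%E = (\int[@lebesgue_measure R]_(s in `](2 * T0)%R, b[) cst M%:E s)%E)//.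
    rewrite integral_cst//= lebesgue_measure_itv/= lte_fin.
    have -> : 2 * T0 < b by rewrite /b; lra.
    rewrite -EFinD -EFinM lee_fin -/M mulrC le_eqVlt; apply/orP; left; apply/eqP; congr (_ * _).
    by rewrite /h /b; field.
  apply: V_source => //; [by rewrite mulr_gt0|by rewrite /b; lra|by rewrite /b; lra|].
  move=> s; rewrite in_itv/= /b => /andP[as_ sb].
  have s0 : 0 < s by lra.
  have ts : s < t by lra.
  have hts : h <= t - s by rewrite /h; lra.
  have H := @source_lower L c low c_gt0 t s x (fun=> -1) (fun=> 1) 2 B s0 ts.
  apply: (le_trans _ (H _ _ _ _ _)) => // {H}.
  - rewrite lee_fin /M ler_pM ?mulr_ge0 ?exprn_ge0 ?powR_ge0 ?(ltW B_gt0) ?(ltW c_gt0)//.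
      have tst : t - s <= t by lra.
      have ts0 : 0 < t - s by lra.
      by rewrite ler_wpM2l ?(ltW c_gt0)// powR_neg_le.
    rewrite ler_wpM2l ?exprn_ge0// -[leLHS](powRr1 (ltW B_gt0)) ler_powR// lerDl.
    exact: ltW.
  - exact: ltW.
  - by move=> i; ring.
  - move=> y yb; apply/cubeP => i; apply: (le_lt_trans (ler_normB _ _)).
    have yi : `|tnth y i| < 1 by have := yb i; rewrite in_itv/= ltr_norml.
    have xi : `|tnth x i| <= norm1Rd x by rewrite /norm1Rd (bigD1 i)//= lerDl sumr_ge0.
    have H1 : h `^ theta <= (t - s) `^ theta.
      by rewrite ge0_ler_powR ?nnegrE ?(ltW th0) ?(ltW h0)// ltW// subr_gt0.
    have H2 : norm1Rd x + 1 <= L * (t - s) `^ theta.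
      rewrite -[leLHS](divfK (lt0r_neq0 hth)) -/L.
      by rewrite ler_wpM2l// ltW.
    lra.
  (* Taking T = s/2 puts s at the left end of [2T, 3T]; since s/2 >= 1, the cube of radius
     (s/2)^theta contains the unit cube. *)
  - move=> y yb; rewrite (hT (s / 2) s y); first by rewrite leey.
    + lra.
    + lra.
    + lra.
    apply/cube0P => i.
    have yi : `|tnth y i| < 1 by have := yb i; rewrite in_itv/= ltr_norml.
    apply: (lt_le_trans yi).
    have s1 : 1 <= s / 2 by rewrite ler_pdivlMr//; lra.
    by rewrite -[leLHS](powRr0 (s / 2)) ler_powR// ltW.
have V0t := V_ge0 x t_gt0.
apply/eqP; rewrite eq_le leey/=; apply/negPn/negP => Vlt.
have {}Vlt : (V t x < +oo)%E by rewrite ltNge.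
move: V0t Vlt HB; case: (V t x) => [v| |]// v0 _ HB.
pose M := h * (c * t `^ (- kappa) * 2 ^+ d).
have M0 : 0 < M.
  apply: mulr_gt0 => //; apply: mulr_gt0; last exact: exprn_gt0.
  by apply: mulr_gt0 => //; exact: powR_gt0.
rewrite lee_fin in v0.
have B1 : 1 <= 1 + v / M by rewrite lerDl divr_ge0// ltW.
have := HB _ B1; apply/negP; rewrite -ltNge lte_fin.
have -> : h * (c * t `^ (- kappa) * (2 ^+ d * (1 + v / M))) = M * (1 + v / M) by rewrite /M; ring.
by rewrite mulrDr mulr1 mulrCA divff ?mulr1 ?ltrDr// gt_eqF.
Qed.

End blow_up.

(** * From the integral equation to the abstract blow-up statement *)

Theorem theorem1p1 (R : realType) (d : nat) (alpha beta eta : R)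
  (p : R -> d.-tuple R -> R) (g : R -> R)
  (V0 : d.-tuple R -> R) (V : R -> d.-tuple R -> \bar R) :
  (0 < d)%N ->
  0 < alpha -> alpha < 2 ->
  0 < beta -> beta < 1 ->
  0 < eta -> eta <= alpha / (beta * d%:R) ->
  is_sym_stable_density alpha p ->
  is_stable_subordinator_density beta g ->
  measurable_fun [set: d.-tuple R] V0 ->
  (forall y, 0 <= V0 y) ->
  (0 < intRd (fun y => (V0 y)%:E))%E ->
  measurable_fun ((`]0%R, +oo[%classic : set R) `*` [set: d.-tuple R]) (fun z : R * d.-tuple R => V z.1 z.2) ->
  (forall t x, 0 < t -> (0 <= V t x)%E) ->
  (forall t x, 0 < t ->
     V t x =
       (intRd (fun y => Gkernel beta p g t (subRd x y) * (V0 y)%:E)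
      + intRd (fun y =>
          \int[@lebesgue_measure R]_(s in (`]0%R, t[%classic : set R))
             (Gkernel beta p g (t - s) (subRd x y) * poweR (V s y) (1 + eta))))%E) ->
  exists t0, 0 < t0 /\ forall t x, t0 < t -> V t x = +oo%E.
Proof.
move=> d0 a0 _ b0 b1 eta0 etal hp hg mV0 V00 V0_gt0 mV V_ge0 VE.
pose G := GkernelT beta p g.
have mG : measurable_fun setT G by exact: measurable_GkernelT hp hg.
have G0 z : (0 <= G z)%E by exact: GkernelT_ge0 hp hg z.
have d0R : 0 < d%:R :> R by rewrite ltr0n.
have mGx t x : measurable_fun setT (fun y => G (t, subRd x y)).
  exact: (measurableT_comp mG (measurableT_comp (pair1_measurable t) (measurable_subRd x))).
have mV0E : measurable_fun setT (EFin \o V0) by exact/measurable_EFinP.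
have V00E y : (0 <= (V0 y)%:E)%E by rewrite lee_fin.
pose D : set (R * d.-tuple R) := (`]0%R, +oo[%classic : set R) `*` setT.
have mD : measurable D by apply: measurableX; [exact: measurable_itv|exact: measurableT].
pose Ve : R * d.-tuple R -> \bar R := (fun z => V z.1 z.2) \_ D.
have mVe : measurable_fun setT Ve by exact: ((measurable_restrictT _ mD).1 mV).
have VeE s y : 0 < s -> Ve (s, y) = V s y.
  by move=> s0; rewrite /Ve patchE mem_set//; split => //=; rewrite in_itv/= s0.
(* [I] is the source term with the time integral moved outside by Tonelli, so that the spatial
   integrals can be bounded below one time s after another. *)
have sumE t x : 0 < t -> exists2 I : \bar R, (0 <= I)%E &
    V t x = (\int[lebRd R d]_y (G (t, subRd x y) * (V0 y)%:E) + I)%E /\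
    forall a b (phi : R -> R), 0 < a -> b <= t ->
      measurable_fun (`]a, b[%classic : set R) phi -> (forall s, s \in `]a, b[ -> 0 <= phi s) ->
      (forall s, s \in `]a, b[ ->
        ((phi s)%:E <= \int[lebRd R d]_y (G ((t - s)%R, subRd x y) * poweR (V s y) (1 + eta)%R))%E) ->
      (\int[@lebesgue_measure R]_(s in `]a, b[) (phi s)%:E <= I)%E.
  move=> t0.
  pose J (z : R * d.-tuple R) := (G ((t - z.1)%R, subRd x z.2) * poweR (Ve z) (1 + eta)%R)%E.
  have mJ : measurable_fun setT J.
    apply: emeasurable_funM; last exact: (measurableT_comp (@measurable_poweR R (1 + eta)) mVe).
    apply: (measurableT_comp mG); apply/measurable_fun_pairP; split.
      by apply: (@measurable_funB _ _ _ _ (cst t) fst) => //; exact: measurable_fst.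
    exact: (measurableT_comp (measurable_subRd x) measurable_snd).
  have J0 z : (0 <= J z)%E by rewrite mule_ge0// poweR_ge0.
  pose E : set (R * d.-tuple R) := (`]0%R, t[%classic : set R) `*` setT.
  have mE : measurable E by apply: measurableX; [exact: measurable_itv|exact: measurableT].
  (* The cut-off to 0 < s < t, where [G] and [Ve] agree with the given kernel and V. *)
  pose H := J \_ E.
  have mH : measurable_fun setT H.
    by apply: ((measurable_restrictT _ mE).1 _); exact: measurable_funTS.
  have H0 z : (0 <= H z)%E by rewrite /H patchE; case: ifPn.
  have HE s y : 0 < s -> s < t -> H (s, y) = (G ((t - s)%R, subRd x y) * poweR (V s y) (1 + eta)%R)%E.
    move=> s0 st; rewrite /H patchE mem_set; last by split => //=; rewrite in_itv/= s0.
    by rewrite /J/= VeE.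
  exists (\int[@lebesgue_measure R]_s \int[lebRd R d]_y H (s, y))%E.
    by apply: integral_ge0 => s _; exact: integral_ge0.
  split.
    rewrite VE//; congr (_ + _)%E.
      rewrite -intRd_lebRd; last 2 first.
      - by apply: emeasurable_funM.
      - by move=> y; rewrite mule_ge0.
      by congr intRd; apply/funext => y; rewrite GkernelTE.
    rewrite fubini_tonelli// -intRd_lebRd; last 2 first.
    - exact: measurable_fun_fubini_tonelli_G.
    - by move=> y; exact: integral_ge0.
    congr intRd; apply/funext => y; rewrite integral_mkcond; apply: eq_integral => s _.
    rewrite patchE; case: ifPn => [/set_mem/=|/negP sN].
      by rewrite in_itv/= => /andP[s0 st]; rewrite HE// GkernelTE ?subr_gt0.
    by rewrite /H patchE memNset// => -[/= st _]; apply: sN; exact: mem_set.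
  move=> a b phi a_gt0 bt mphi phi0 phiH.
  have sub s : s \in `]a, b[ -> 0 < s /\ s < t.
    by rewrite in_itv/= => /andP[as_ sb]; rewrite (lt_trans a_gt0)// (lt_le_trans sb).
  have mF : measurable_fun setT (fun s => \int[lebRd R d]_y H (s, y))%E.
    exact: (measurable_integral_param (lebRd R d) mH).
  apply: (@le_trans _ _ (\int[@lebesgue_measure R]_(s in `]a, b[) \int[lebRd R d]_y H (s, y))%E).
    apply: ge0_le_integral => //.
    - exact/measurable_EFinP.
    - exact: measurable_funTS.
    move=> s sab; have [s0 st] := sub s sab; apply: (le_trans (phiH s sab)).
    by under [leRHS]eq_integral do rewrite HE//.
  apply: ge0_subset_integral => // s _; exact: integral_ge0.
have th0 : 0 < beta / alpha by exact: divr_gt0.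
have crit : beta / alpha * d%:R * eta <= 1.
  have -> : beta / alpha * d%:R * eta = eta / (alpha / (beta * d%:R)).
    by field; rewrite !gt_eqF.
  by rewrite ler_pdivrMr ?mul1r// divr_gt0// mulr_gt0.
apply: (@blow_up R d (beta / alpha) eta G th0 eta0 crit _ V0 V).
- move=> L L0; have [c c0 H] := Gkernel_convolution_lower d0 a0 b0 b1 hp hg L0.
  by exists c => //; rewrite mulrAC.
- exact: mV0.
- exact: V00.
- by rewrite -intRd_lebRd.
- move=> s s0; rewrite (_ : V s = Ve \o pair s); first exact: (measurableT_comp mVe (pair1_measurable s)).
  by apply/funext => y /=; rewrite VeE.
- exact: V_ge0.
- by move=> t x t0; have [I I0 [-> _]] := sumE t x t0; rewrite leeDl.
move=> t x a b phi a_gt0 ab bt mphi phi0 phiH.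
have t0 : 0 < t by rewrite (lt_le_trans a_gt0)// (le_trans ab).
have [I I0 [-> HI]] := sumE t x t0.
apply: (le_trans (HI a b phi a_gt0 bt mphi phi0 phiH)).
by rewrite leeDr// integral_ge0// => y _; rewrite mule_ge0.
Qed.
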